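(* Let $\{X_n\}_{n\ge1}$ be random variables with values in $\mathbb{N}_0=\{0,1,2,\ldots\}$, with probability generating functions $\mathsf{G}_{X_n}$. Let $\mathsf{G}_{X_n}$ be holomorphic in $D_{\eta+\tau_n}(0)$ for every $n\in\mathbb{N}$, with $\eta>3$ independent of $n$ and $\tau_n>0$. Moreover, suppose that $\mathsf{G}_{X_n}$ can be written as $$\mathsf{G}_{X_n}(s)=\exp\{\lambda_n(s-1)\}\,s^h\,[g(s)+\epsilon_n(s)]$$ for every $s\in D_{\eta+\tau_n}(0)$, where: (i) $\{\lambda_n\}_{n\ge1}$ is a diverging sequence of positive numbers; (ii) $h\in\mathbb{N}_0$ is a constant, independent of $n$; (iii) the restriction of $g$ to $D_\eta(0)$ is independent of $n$ and holomorphic on that domain, with $g(1)=1$ and $g(0)\ne0$; (iv) $\epsilon_n$ is holomorphic in $D_\eta(0)$ and satisfies $K(\eta-1)<+\infty$, where $$K(\delta):=\sup_{n\in\mathbb{N}}\ \sup_{0<|s-1|<\delta}\lambda_n\left|\frac{\epsilon_n(s)}{s-1}\right|.$$ Then there exist some $n_0\in\mathbb{N}$ and $C(\eta)>0$, independent of $n$, such that $$\sum_{k\ge h}\left|\mathsf{P}[X_n=k]-\exp\{-[\lambda_n+g'(1)]\}\frac{[\lambda_n+g'(1)]^{k-h}}{(k-h)!}\right|\le\frac{C(\eta)}{\lambda_n}$$ holds for every $n\ge n_0$.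
   Context: $\mathbb{N}=\{1,2,\ldots\}$. $D_r(z_0)$ denotes the open disc in $\mathbb{C}$ of radius $r$ centered at $z_0$. The probability generating function of an $\mathbb{N}_0$-valued random variable $X$ is $\mathsf{G}_X(s):=\sum_{x\ge0}\mathsf{P}[X=x]s^x$. ''Diverging'' means $\lambda_n\to+\infty$. $\lambda_n+g'(1)>0$ holds for all sufficiently large $n$. *)

(* Defs.v *)
(* Complex numbers are R[i] with R : realType; the topology is that of R[i]^o,
   which comes from the modulus. *)
From HB Require Import structures.
From mathcomp Require Import all_boot all_order all_algebra.
From mathcomp Require Import complex.
From mathcomp Require Import all_classical all_reals all_analysis.

Set Implicit Arguments.
Unset Strict Implicit.
Unset Printing Implicit Defensive.

Import Order.TTheory GRing.Theory Num.Theory.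
Import numFieldNormedType.Exports.

Local Open Scope classical_set_scope.
Local Open Scope ring_scope.
Local Open Scope complex_scope.

Section complex_analysis.
Context {R : realType}.

(* [Normc.normc] is the modulus with values in R; the generic norm `|z| of the
   numFieldType R[i] takes its values in R[i]. *)
Definition disc (z0 : R[i]) (r : R) : set R[i]^o :=
  [set s | Normc.normc (s - z0) < r].

Definition expC (z : R[i]) : R[i] :=
  (expR (complex.Re z) * cos (complex.Im z)) +i*
  (expR (complex.Re z) * sin (complex.Im z)).

(* The scalar field of R[i]^o is R[i], so [derivable f z 1] says that
   h^-1 * (f (z + h) - f z) converges as h tends to 0 in R[i]. *)
Definition holomorphic_in (D : set R[i]^o) (f : R[i]^o -> R[i]^o) : Prop :=
  forall z, D z -> derivable f z 1.

End complex_analysis.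

Section generating_function.
Context {R : realType} {d : measure_display} {T : measurableType d}.
Context {P : probability T R}.

Definition pr_eq (X : {RV P >-> nat}) (k : nat) : R :=
  fine (P (X @^-1` [set k])).

Definition pgf_series (X : {RV P >-> nat}) (s : R[i]) : nat -> R[i]^o :=
  [series (pr_eq X k)%:C * s ^+ k]_k.

(* [lim] has a junk value where the series diverges; hence the convergence
   clause in [pgf_holomorphic_in]. *)
Definition pgf (X : {RV P >-> nat}) (s : R[i]^o) : R[i]^o :=
  limn (pgf_series X s).

Definition pgf_holomorphic_in (D : set R[i]^o) (X : {RV P >-> nat}) : Prop :=
  (forall s, D s -> cvgn (pgf_series X s)) /\ holomorphic_in D (pgf X).

End generating_function.

Section supremum.
Context {R : realType}.

(* Sequences are indexed by n >= 1: the term of index 0 is never used. *)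
Definition Ksup (lam : nat -> R) (eps : nat -> R[i] -> R[i]) (delta : R)
    : \bar R :=
  ereal_sup [set ereal_sup
      [set (lam n * Normc.normc (eps n s / (s - 1)))%:E
         | s in [set s : R[i] | 0 < Normc.normc (s - 1) < delta]]
    | n in [set n : nat | (0 < n)%N]].

End supremum.

(* Main.v *)
(* Put H_n = g + eps_n and let p_k = P[X_n = k], so that
   sum_k p_k s^k = exp(lam_n (s - 1)) s^h H_n(s).  Since the left-hand side is a
   power series vanishing to order h at 0, multiplying it by the exponential
   series shows that H_n(s) = sum_k c_k s^k on 0 < |s| < eta, with real c_k.  In
   terms of convolutions, (p_(k+h))_k is Poisson(lam_n) * c.
   With a = g'(1), which is real because the H_n are real on the real axis, the
   difference to be estimated is therefore Poisson(lam_n) * w, where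
   w = c - Poisson(a) has the generating function H_n(s) - exp(a (s - 1)).
   Pick 1 < r < eta - 2: the circle |s| = r lies in |s - 1| < eta - 1, where
   eps_n is O(1 / lam_n), so H_n is bounded on it uniformly in n, and Cauchy's
   estimate gives w_k = O(r^-k).  Moreover w has sum 0 and mean O(1 / lam_n), so
   its generating function is b (s - 1) + (s - 1)^2 V(s) with b = O(1 / lam_n)
   and V bounded in l^1.  The first difference of the Poisson(lam) weights has
   l^1 norm at most 2 and the second one at most 2 / lam; Young's inequality
   concludes.
   Cauchy's estimate is only needed for power series, where it follows by
   averaging over roots of unity; no complex integration is used. *)
Require Import Defs.
From HB Require Import structures.
From mathcomp Require Import all_boot all_order all_algebra.
From mathcomp Require Import complex.
From mathcomp Require Import separable cyclotomic cyclic.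
From mathcomp Require Import all_classical all_reals all_analysis.
From mathcomp Require Import ring lra zify.

Set Implicit Arguments.
Unset Strict Implicit.
Unset Printing Implicit Defensive.

Import Order.TTheory GRing.Theory Num.Theory.
Import numFieldNormedType.Exports.

Local Open Scope classical_set_scope.
Local Open Scope ring_scope.
Local Open Scope complex_scope.

Import Normc.

(** * Convolution of sequences *)

Section convolution.
Context {K : comNzRingType}.
Implicit Types u v w : nat -> K.

Definition convol u v (n : nat) : K := \sum_(i < n.+1) u i * v (n - i)%N.

(** Only entries of index at most [k] enter, so the sequences may be truncated to polynomials;
    commutativity and associativity are then inherited from the polynomial ring. *)
Lemma convol_coef u v n k : (k < n)%N ->
  convol u v k = (\poly_(i < n) u i * \poly_(i < n) v i)`_k.
Proof.
move=> kn; rewrite coefM; apply: eq_bigr => i _.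
rewrite !coef_poly (leq_ltn_trans (leq_subr _ _) kn).
by rewrite (leq_ltn_trans _ kn) // -ltnS.
Qed.

Lemma convolC u v : convol u v = convol v u.
Proof. by apply/funext => n; rewrite !(@convol_coef _ _ n.+1) // mulrC. Qed.

Lemma convolA u v w : convol u (convol v w) = convol (convol u v) w.
Proof.
apply/funext => n.
pose p (x : nat -> K) := \poly_(i < n.+1) x i.
transitivity ((p u * (p v * p w))`_n).
  rewrite coefM; apply: eq_bigr => i _.
  rewrite coef_poly ltn_ord (@convol_coef _ _ n.+1) //.
  by rewrite ltnS leq_subr.
rewrite mulrA coefM; apply: eq_bigr => i _.
by rewrite coef_poly ltnS leq_subr (@convol_coef _ _ n.+1).
Qed.

Lemma convolDr u v w n : convol u (fun k => v k + w k) n =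
  convol u v n + convol u w n.
Proof. by rewrite -big_split; apply: eq_bigr => i _; rewrite mulrDr. Qed.

Lemma convolBr u v w n : convol u (fun k => v k - w k) n =
  convol u v n - convol u w n.
Proof. by rewrite -sumrB; apply: eq_bigr => i _; rewrite mulrBr. Qed.

Lemma convolZr u v a n : convol u (fun k => a * v k) n = a * convol u v n.
Proof. by rewrite mulr_sumr; apply: eq_bigr => i _; rewrite mulrCA. Qed.

Lemma convol_geometric u v s n :
  convol (fun k => u k * s ^+ k) (fun k => v k * s ^+ k) n =
    convol u v n * s ^+ n.
Proof.
rewrite mulr_suml; apply: eq_bigr => i _.
by rewrite mulrACA -exprD subnKC // -ltnS.
Qed.

(** Every pair [(i, j)] lies on one antidiagonal, and the antidiagonals below [N] fill a triangle.
    Comparing triangles with squares yields the bounds on partial sums further down. *)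
Lemma convol_sum u v N :
  \sum_(k < N) convol u v k = \sum_(i < N) \sum_(j < N | (i + j < N)%N) u i * v
    j.
Proof.
have E (k : 'I_N) :
    convol u v k = \sum_(i < N) \sum_(j < N | (i + j)%N == k) u i * v j.
  rewrite /convol (big_ord_widen N (fun i => u i * v (k - i)%N)) //.
  rewrite [RHS](bigID (fun i : 'I_N => (i < k.+1)%N)) /= [X in _ = _ + X]big1;
    last first.
    move=> i; rewrite ltnS -ltnNge => ki; apply: big1 => j /eqP jk.
    by move: ki; rewrite -jk ltnNge leq_addr.
  rewrite addr0; apply: eq_bigr => i; rewrite ltnS => ik.
  have jN : (k - i < N)%N by rewrite (leq_ltn_trans (leq_subr _ _)).
  rewrite (big_pred1 (Ordinal jN)) // => j; rewrite /= -val_eqE /=.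
  by rewrite -(eqn_add2l i j) subnKC.
under eq_bigr do rewrite E.
rewrite exchange_big; apply: eq_bigr => i _ /=.
rewrite (exchange_big_dep predT) //= [RHS]big_mkcond /=; apply: eq_bigr => j _.
case: ifP => ij; last first.
  by apply: big1 => k /eqP ijk; move: (ltn_ord k); rewrite -ijk ij.
by rewrite (big_pred1 (Ordinal ij)) // => k; rewrite -val_eqE /= eq_sym.
Qed.

Definition delta0 (k : nat) : K := (k == 0)%:R.

(* The coefficients of the polynomial s - 1. *)
Definition diffseq (k : nat) : K :=
  if k is k'.+1 then (k' == 0)%:R else -1.

Lemma convol_delta0 u : convol u delta0 = u.
Proof.
apply/funext => n; rewrite /convol big_ord_recr /= subnn mulr1 big1 ?add0r // =>
  i _.
by rewrite /delta0 subn_eq0 leqNgt ltn_ord mulr0.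
Qed.

Lemma convol_diff0 u : convol diffseq u 0 = - u 0.
Proof. by rewrite /convol big_ord_recr big_ord0 /= add0r mulN1r. Qed.

Lemma convol_diffS u n : convol diffseq u n.+1 = u n - u n.+1.
Proof.
rewrite /convol 2!big_ord_recl /= mulN1r mul1r subSS subn0 big1 => [|i _];
  last by rewrite /= mul0r.
by rewrite subn0 addr0 addrC.
Qed.

(** Multiplication by [s - 1] seen on partial sums: cutting off at a finite index leaves one
    boundary term. *)
Lemma sum_convol_diff u s N :
  \sum_(k < N.+1) convol diffseq u k * s ^+ k =
  (s - 1) * \sum_(k < N) u k * s ^+ k - u N * s ^+ N.
Proof.
elim: N => [|N IH].
  by rewrite big_ord_recr !big_ord0 /= convol_diff0; ring.
rewrite big_ord_recr IH /= convol_diffS [X in _ = _ * X - _]big_ord_recr /=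
  exprS.
ring.
Qed.

End convolution.

Section real_convolution.
Context {R : realFieldType}.
Implicit Types u v : nat -> R.

(** Young's inequality in l^1: the triangle [i + j < N] lies in the square of side [N]. *)
Lemma sum_norm_convol u v N :
  \sum_(k < N) `|convol u v k| <= (\sum_(k < N) `|u k|) * (\sum_(k < N) `|v k|).
Proof.
apply: (@le_trans _ _ (\sum_(k < N) convol (fun i => `|u i|) (fun i => `|v i|)
  k)).
  apply: ler_sum => k _; apply: le_trans (ler_norm_sum _ _ _) _.
  by apply: ler_sum => i _; rewrite normrM.
rewrite convol_sum mulr_suml; apply: ler_sum => i _; rewrite mulr_sumr.
by rewrite [leRHS](bigID (fun j : 'I_N => (i + j < N)%N)) /= lerDl sumr_ge0.
Qed.

(** The square of side [N] lies in the triangle [i + j < N + N]. This reverse comparison serves the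
    Cauchy product. *)
Lemma le_sum_convol u v N : (forall k, 0 <= u k) -> (forall k, 0 <= v k) ->
  (\sum_(k < N) u k) * (\sum_(k < N) v k) <= \sum_(k < N + N) convol u v k.
Proof.
move=> u0 v0; rewrite convol_sum mulr_suml.
have NN : (N <= N + N)%N by rewrite leq_addr.
rewrite (big_ord_widen _ (fun i => u i * \sum_(k < N) v k) NN).
rewrite [leRHS](bigID (fun j : 'I_(N + N) => (j < N)%N)) /=.
apply: ler_wpDr; first by do 2 (apply: sumr_ge0 => ? _); rewrite mulr_ge0.
apply: ler_sum => i iN; rewrite mulr_sumr.
rewrite (big_ord_widen _ (fun j => u i * v j) NN).
rewrite [leLHS]big_mkcond [leRHS]big_mkcond /=; apply: ler_sum => j _.
case: ifP => jN; last by case: ifP => // _; rewrite mulr_ge0.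
rewrite ifT // -addnS leq_add //; exact: ltnW.
Qed.

End real_convolution.

Lemma convol_exp_coeff (K : numFieldType) (a b : K) :
  convol (fun k => a ^+ k / k`!%:R) (fun k => b ^+ k / k`!%:R) =
  (fun k => (a + b) ^+ k / k`!%:R).
Proof.
rewrite convolC; apply/funext => n; rewrite /convol exprDn mulr_suml.
apply: eq_bigr => i _; have lein : (i <= n)%N by rewrite -ltnS.
rewrite -(bin_fact lein) !natrM -[_ *+ 'C(_, _)]mulr_natr.
have : 'C(n, i)%:R != 0 :> K by rewrite pnatr_eq0 -lt0n bin_gt0.
have : i`!%:R != 0 :> K by rewrite pnatr_eq0 -lt0n fact_gt0.
have : (n - i)`!%:R != 0 :> K by rewrite pnatr_eq0 -lt0n fact_gt0.
move: ('C(n, i)%:R : K) (i`!%:R : K) ((n - i)`!%:R : K) => x y z z0 y0 x0.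
by field; rewrite x0 y0 z0.
Qed.

(** * Poisson weights and their second differences *)

Section poisson.
Context {R : realType}.

(** The parameter may be negative: [poisson (- l)] is the convolution inverse of [poisson l], and
    [g'(1)] has no prescribed sign. *)
Definition poisson (l : R) (k : nat) : R := expR (- l) * (l ^+ k / k`!%:R).

Lemma poisson_ge0 l k : 0 <= l -> 0 <= poisson l k.
Proof. by move=> l0; rewrite mulr_ge0 ?expR_ge0 // divr_ge0 ?exprn_ge0
  ?ler0n. Qed.

Lemma poissonS (l : R) k : poisson l k.+1 * k.+1%:R = l * poisson l k.
Proof.
rewrite /poisson factS natrM exprS; field.
by rewrite pnatr_eq0 -lt0n fact_gt0 addrC natr1 pnatr_eq0.
Qed.

Lemma convol_poisson (l m : R) : convol (poisson l) (poisson m) =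
  poisson (l + m).
Proof.
apply/funext => n; rewrite convolZr convolC convolZr convol_exp_coeff.
by rewrite /poisson opprD expRD addrC mulrCA mulrA.
Qed.

Lemma poisson0 : poisson 0 = delta0.
Proof.
apply/funext => -[|k]; rewrite /poisson /delta0 oppr0 expR0 mul1r.
  by rewrite expr0 fact0 divr1.
by rewrite exprS !mul0r.
Qed.

Lemma sum_exp_coeff_le (l : R) N : 0 <= l ->
  \sum_(k < N) l ^+ k / k`!%:R <= expR l.
Proof.
move=> l0; have := @nondecreasing_cvgn_le _ (series (exp_coeff l)) _ _ N.
rewrite /series /= big_mkord; apply; last exact: is_cvg_series_exp_coeff.
by apply: nondecreasing_series => n _ _; exact: exp_coeff_ge0.
Qed.

Lemma sum_poisson_le1 (l : R) N : 0 <= l -> \sum_(k < N) poisson l k <= 1.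
Proof.
move=> l0; rewrite -(expRxMexpNx_1 l) mulrC /poisson -mulr_sumr.
by rewrite ler_wpM2l ?expR_ge0 ?sum_exp_coeff_le.
Qed.

(** By [poissonS] the two preceding weights are [k / l] and [k (k - 1) / l^2] times the weight at
    [k]. The indices 0 and 1, where preceding weights are missing, are treated apart. *)
Lemma diff2_poisson (l : R) k : l != 0 ->
  convol diffseq (convol diffseq (poisson l)) k =
  poisson l k * ((k%:R - l) ^+ 2 - k%:R) / l ^+ 2.
Proof.
move=> l0; have E n : poisson l n = poisson l n.+1 * n.+1%:R / l.
  by rewrite poissonS mulrC mulKf.
case: k => [|[|k]]; first by rewrite !convol_diff0; field.
  by rewrite convol_diffS convol_diff0 convol_diffS (E 0%N); field.
by rewrite !convol_diffS (E k) (E k.+1) -!natr1; field.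
Qed.

(** Induction with [poissonS]. The boundary term is kept exactly, because its sign decides the bound
    for finite [N]. *)
Lemma sum_poisson_moment (l : R) N :
  \sum_(k < N.+2) poisson l k * ((k%:R - l) ^+ 2 + k%:R) =
  2 * l * \sum_(k < N.+1) poisson l k + l ^+ 2 * (poisson l N.+1 - poisson l N).
Proof.
elim: N => [|N IH].
  rewrite !big_ord_recr !big_ord0 /=.
  by have := poissonS l 0; rewrite mulr1 => ->; ring.
rewrite big_ord_recr IH /= [X in _ = 2 * l * X + _]big_ord_recr /=.
set S := \sum_(_ < _) _.
have E1 := poissonS l N; have E2 := poissonS l N.+1.
rewrite -[N.+2%:R]natr1 -[N.+1%:R]natr1 in E1 E2 *.
have -> : l ^+ 2 * (poisson l N.+2 - poisson l N.+1) =
  l ^+ 2 * poisson l N.+2 - l * (l * poisson l N.+1) by ring.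
have -> : l ^+ 2 * (poisson l N.+1 - poisson l N) =
  l * (l * poisson l N.+1) - l * (l * poisson l N) by ring.
have -> : 2 * l * (S + poisson l N.+1) =
  2 * l * S + 2 * (l * poisson l N.+1) by ring.
have -> : l * (l * poisson l N) = poisson l N.+2 * (N%:R + 1 + 1) * (N%:R + 1).
  by rewrite -E1 mulrA -E2.
rewrite -E2; ring.
Qed.

(* The second difference of the Poisson weights is, up to the factor l^-2, the
   weight times (k - l)^2 - k, and both (k - l)^2 and k have mean l. *)
Lemma sum_diff2_poisson (l : R) N : 0 < l ->
  \sum_(k < N) `|convol diffseq (convol diffseq (poisson l)) k| <= 2 / l.
Proof.
move=> l0; have l1 := ltW l0.
pose f k := poisson l k * ((k%:R - l) ^+ 2 + k%:R).
have f0 k : 0 <= f k by rewrite mulr_ge0 ?poisson_ge0 ?addr_ge0 ?sqr_ge0.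
have fle k : `|convol diffseq (convol diffseq (poisson l)) k| <= f k / l ^+ 2.
  rewrite diff2_poisson ?gt_eqF // /f normrM [`|poisson l k * _|]normrM.
  rewrite [X in _ * X <= _]ger0_norm ?invr_ge0 ?exprn_ge0 //.
  rewrite (ger0_norm (poisson_ge0 k l1)).
  rewrite ler_wpM2r ?invr_ge0 ?exprn_ge0 // ler_wpM2l ?poisson_ge0 //.
  by apply: le_trans (ler_normB _ _) _; rewrite !ger0_norm ?sqr_ge0 ?ler0n.
apply: le_trans (ler_sum _ (fun (k : 'I_N) _ => fle k)) _.
rewrite -mulr_suml ler_pdivrMr ?exprn_gt0 //.
have -> : 2 / l * l ^+ 2 = 2 * l by field; rewrite gt_eqF.
(* Beyond [l] the Poisson weights decrease. Enlarging the range to [M.+2] terms therefore makes the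
   boundary term of [sum_poisson_moment] nonpositive. *)
pose M := (N + Num.truncn l)%N.
have NM : (N <= M.+2)%N by rewrite /M -addnS -addnS leq_addr.
apply: (@le_trans _ _ (\sum_(k < M.+2) f k)).
  rewrite (big_ord_widen _ f NM) [leRHS](bigID (fun k : 'I_M.+2 => (k < N)%N))
    /=.
  by rewrite lerDl sumr_ge0.
rewrite sum_poisson_moment.
have : poisson l M.+1 <= poisson l M.
  rewrite -(ler_pM2r l0) [leRHS]mulrC -poissonS ler_wpM2l ?poisson_ge0 //.
  apply: ltW; apply: lt_le_trans (truncnS_gt l) _.
  by rewrite ler_nat ltnS leq_addl.
rewrite -subr_le0 => MS.
have := sum_poisson_le1 M.+1 l1; set S := \sum_(_ < _) _ => S1.
have : l ^+ 2 * (poisson l M.+1 - poisson l M) <= 0.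
  by rewrite mulr_ge0_le0 ?exprn_ge0.
by move: (ler_wpM2l l1 S1); lra.
Qed.

End poisson.

(** * Tails of geometrically decaying sequences *)

Section geometric_tails.
Context {R : realType}.
Variables (M rho : R).
Hypothesis rho01 : 0 < rho < 1.

Lemma sum_geometric_le N : 0 <= M -> \sum_(k < N) M * rho ^+ k <= M / (1 - rho).
Proof.
case/andP: rho01 => r0 r1 M0.
rewrite -mulr_sumr ler_wpM2l // -[leRHS]mul1r ler_pdivlMr ?subr_gt0 //.
have -> : (\sum_(k < N) rho ^+ k) * (1 - rho) = 1 - rho ^+ N.
  by rewrite mulrC -(opprB rho) mulNr -subrX1 opprB.
by rewrite gerBl exprn_ge0 ?ltW.
Qed.

(** [U] is the sum of the series. The bound on a block from [k] to [m] does not depend on [m], so it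
    survives the limit in [m]. *)
Lemma geometric_tail (u : nat -> R) : (forall k, `|u k| <= M * rho ^+ k) ->
  exists U, forall k,
    `|U - \sum_(j < k) u j| <= M / (1 - rho) * rho ^+ k.
Proof.
case/andP: rho01 => r0 r1 uM.
have M0 : 0 <= M by have := uM 0%N; rewrite mulr1; apply: le_trans.
have diff m k : (k <= m)%N ->
    `|\sum_(j < m) u j - \sum_(j < k) u j| <= M / (1 - rho) * rho ^+ k.
  move=> km.
  rewrite -!(big_mkord xpredT u) (@big_cat_nat _ _ _ k 0 m) //= addrAC subrr
    add0r.
  rewrite -{1}[k]add0n big_addn big_mkord.
  apply: le_trans (ler_norm_sum _ _ _) _.
  apply: (@le_trans _ _ (\sum_(j < m - k) M * rho ^+ j * rho ^+ k)).
    by apply: ler_sum => j _; rewrite -mulrA -exprD.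
  by rewrite -mulr_suml ler_wpM2r ?exprn_ge0 ?(ltW r0) ?sum_geometric_le.
have cv : cvgn (series u).
  apply: normed_cvg; apply: (@series_le_cvg _ _ (geometric M rho)) => //.
  - by move=> n; rewrite /= normr_ge0.
  - by move=> n; rewrite /= mulr_ge0 ?exprn_ge0 ?(ltW r0).
  - by apply: is_cvg_geometric_series; rewrite gtr0_norm.
exists (limn (series u)) => k; rewrite ler_norml.
have near_k m : (k <= m)%N -> `|series u m - \sum_(j < k) u j| <=
  M / (1 - rho) * rho ^+ k.
  by move=> km; rewrite /series /= big_mkord; exact: diff.
apply/andP; split;
  [rewrite lerBrDl; apply: limr_ge => // | rewrite lerBlDl; apply: limr_le =>
    //];
  near=> m; have /near_k : (k <= m)%N by near: m; exact: nbhs_infty_ge.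
  by rewrite ler_norml lerBrDl => /andP[].
by rewrite ler_norml lerBlDl => /andP[].
Unshelve. all: by end_near. Qed.

End geometric_tails.

(** * Division of generating functions by [s - 1], and the l^1 estimate *)

Section summation_by_parts.
Context {R : realType}.
Variable rho : R.
Hypothesis rho01 : 0 < rho < 1.

(** Division by [s - 1] with remainder: [A] is the sum of [w] and [W k] its tail beyond [k], which
    decays at the same rate. The last clause is the identity for partial sums, ready for a limit in
    [N]. *)
Lemma geometric_diff (M : R) (w : nat -> R) : (forall k, `|w k| <= M * rho ^+ k)
  ->
  exists (A : R) (W : nat -> R),
    (forall k, `|W k| <= M / (1 - rho) * rho ^+ k) /\
    w = (fun k => A * delta0 k + convol diffseq W k) /\
    (forall s N, \sum_(k < N.+1) w k * s ^+ k =
       A + (s - 1) * \sum_(k < N) W k * s ^+ k - W N * s ^+ N).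
Proof.
case/andP: (rho01) => r0 r1 wM; have [A tailA] := geometric_tail rho01 wM.
have M0 : 0 <= M by have := wM 0%N; rewrite mulr1; apply: le_trans.
pose W k := A - \sum_(j < k.+1) w j.
have wE : w = (fun k => A * delta0 k + convol diffseq W k).
  apply/funext => -[|k]; rewrite /delta0 /= ?mulr1 ?mulr0 ?add0r.
    by rewrite convol_diff0 /W big_ord_recl big_ord0 addr0; ring.
  by rewrite convol_diffS /W [\sum_(j < k.+2) _]big_ord_recr /=; ring.
exists A, W; split=> [k|]; first last.
  split=> // s N; rewrite -addrA -sum_convol_diff {1}wE big_ord_recl
    big_ord_recl /=.
  rewrite /delta0 /= !expr0 !mulr1 -addrA; congr (_ + (_ + _)).
  by apply: eq_bigr => i _; rewrite /= mulr0 add0r.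
apply: le_trans (tailA k.+1) _.
rewrite ler_wpM2l ?divr_ge0 ?subr_ge0 ?(ltW r1) //.
by rewrite exprS ler_piMl ?exprn_ge0 ?(ltW r0) ?(ltW r1).
Qed.

(* The sequence is (s - 1) b + (s - 1)^2 V(s) as soon as its generating function
   vanishes at 1; b is the derivative there. *)
Lemma geometric_diff2 (M kappa : R) (w : nat -> R) (F : R -> R) :
  (forall k, `|w k| <= M * rho ^+ k) ->
  (forall t, 0 < t < 1 -> (\sum_(k < N) w k * (1 - t) ^+ k) @[N --> \oo] --> F
    t) ->
  (forall e, 0 < e -> exists2 d, 0 < d & forall t, 0 < t < d -> `|F t| <=
    (kappa + e) * t) ->
  exists (b : R) (V : nat -> R),
    [/\ `|b| <= kappa, forall k, `|V k| <= M / (1 - rho) ^+ 2 * rho ^+ k &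
     w = (fun k => b * diffseq k + convol diffseq (convol diffseq V) k)].
Proof.
case/andP: (rho01) => r0 r1 wM cvF smallF.
have M0 : 0 <= M by have := wM 0%N; rewrite mulr1; apply: le_trans.
have [A [W [WM [wE wS]]]] := geometric_diff wM.
have [b [V [VM [WE WS]]]] := geometric_diff WM.
have r1' : 0 < 1 - rho by rewrite subr_gt0.
set Q := M / (1 - rho) / (1 - rho) in VM.
have Q0 : 0 <= Q by rewrite !divr_ge0 // ltW.
(* Second-order expansion of [F] at 0: two divisions, with [s - 1 = - t], leave [t ^+ 2] times a
   bounded partial sum, and the boundary terms collected in [err] vanish as [N] grows. *)
have bound t : 0 < t < 1 -> `|F t - (A - b * t)| <= t ^+ 2 * (Q / (1 - rho)).
  case/andP=> t0 t1; set s := 1 - t.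
  have s01 : 0 <= s <= 1 by rewrite /s; apply/andP; split; lra.
  have Vs k : `|V k * s ^+ k| <= Q * rho ^+ k.
    rewrite normrM -[leRHS]mulr1 ler_pM // normrX exprn_ile1 //.
      by rewrite ger0_norm; case/andP: s01.
  have Ws k : `|W k * s ^+ k| <= M / (1 - rho) * rho ^+ k.
    rewrite normrM -[leRHS]mulr1 ler_pM // normrX exprn_ile1 //.
      by rewrite ger0_norm; case/andP: s01.
  pose err N := t * (Q * rho ^+ N) + M / (1 - rho) * rho ^+ N.+1.
  have part N : `|\sum_(k < N.+2) w k * s ^+ k - (A - b * t)| <=
      t ^+ 2 * (Q / (1 - rho)) + err N.
    rewrite wS WS.
    have -> : s - 1 = - t by rewrite /s; ring.
    set S := \sum_(_ < _) _.
    have SQ : `|S| <= Q / (1 - rho).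
      apply: le_trans (ler_norm_sum _ _ _) _.
      by apply: le_trans (sum_geometric_le rho01 N Q0); apply: ler_sum.
    have -> : A + - t * (b + - t * S - V N * s ^+ N) - W N.+1 * s ^+ N.+1 -
      (A - b * t)
      = t ^+ 2 * S + (t * (V N * s ^+ N) - W N.+1 * s ^+ N.+1) by ring.
    apply: le_trans (ler_normD _ _) _; apply: lerD.
      by rewrite normrM ger0_norm ?sqr_ge0 // ler_wpM2l ?sqr_ge0.
    apply: le_trans (ler_normB _ _) _; apply: lerD => //.
    by rewrite normrM gtr0_norm // ler_wpM2l // ltW.
  have cvrho : (rho ^+ N) @[N --> \oo] --> (0 : R).
    by apply: cvg_expr; rewrite gtr0_norm.
  have cverr : err N @[N --> \oo] --> (0 : R).
    rewrite (_ : 0 = t * (Q * 0) + M / (1 - rho) * 0); last by ring.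
    apply: cvgD; first by apply: cvgMl_tmp; apply: cvgMl_tmp.
    by apply: cvgMl_tmp; have := cvrho;
      rewrite -(cvg_shiftS (fun n => rho ^+ n)).
  have cvl := cvF t; rewrite t0 t1 -/s in cvl.
  have {}cvl : `|\sum_(k < N.+2) w k * s ^+ k - (A - b * t)| @[N --> \oo] -->
    `|F t - (A - b * t)|.
    apply: cvg_norm; apply: cvgB; last exact: cvg_cst.
    have := cvl isT.
    rewrite -(cvg_shiftn 2%N).
    by under eq_fun do rewrite addn2.
  have cvr : t ^+ 2 * (Q / (1 - rho)) + err N @[N --> \oo] --> t ^+ 2 *
    (Q / (1 - rho)).
    by rewrite -[X in _ --> X]addr0; apply: cvgD => //; exact: cvg_cst.
  by apply: ler_cvg_to cvl cvr _; apply: nearW.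
set Q' := Q / (1 - rho) in bound.
have Q'0 : 0 <= Q' by rewrite divr_ge0 // ltW.
have est e : 0 < e -> exists2 d, 0 < d & forall t, 0 < t < d ->
    `|A - b * t| <= (kappa + e + t * Q') * t.
  move=> /smallF[d d0 dF]; exists (Num.min d 1);
    first by rewrite lt_min d0 ltr01.
  move=> t /andP[t0]; rewrite lt_min => /andP[td t1].
  have := bound t; rewrite t0 t1 => /(_ isT) bt.
  have := dF t; rewrite t0 td => /(_ isT) Ft.
  have -> : A - b * t = F t - (F t - (A - b * t)) by ring.
  apply: le_trans (ler_normB _ _) _.
  have -> : (kappa + e + t * Q') * t = (kappa + e) * t + t ^+ 2 * Q' by ring.
  exact: lerD.
(* Both [b * t] and the bound in [est] are of order [t], so the constant term must vanish. *)
have A0 : A = 0.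
  apply/eqP; rewrite -normr_le0; apply/ler_addgt0Pr => e e0; rewrite add0r.
  have [d d0 dE] := est 1 ltr01.
  pose B := `|kappa| + 1 + Q' + `|b|.
  have B0 : 0 < B by rewrite /B; have := normr_ge0 kappa; have := normr_ge0 b;
    lra.
  pose t := Num.min (Num.min (d / 2) 1) (e / B).
  have t0 : 0 < t by rewrite !lt_min ltr01 !divr_gt0.
  have td : t < d.
    by apply: (@le_lt_trans _ _ (d / 2)); rewrite /t ?ge_min ?lexx //; lra.
  have t1 : t <= 1 by rewrite /t !ge_min lexx orbT.
  have te : B * t <= e by rewrite mulrC -ler_pdivlMr // /t !ge_min lexx !orbT.
  have := dE t; rewrite t0 td => /(_ isT) Ab.
  have -> : A = (A - b * t) + b * t by ring.
  apply: le_trans (ler_normD _ _) _; apply: le_trans te.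
  rewrite normrM (gtr0_norm t0).
  have -> : B * t = (`|kappa| + 1 + Q') * t + `|b| * t by rewrite /B; ring.
  rewrite lerD2r; apply: le_trans Ab _; rewrite ler_pM2r // !lerD ?ler_norm //.
  by rewrite ler_piMl.
have bk : `|b| <= kappa.
  apply/ler_addgt0Pr => e e0.
  have [d d0 dE] := est (e / 2) ltac:(by rewrite divr_gt0).
  (* The second entry gives [t * Q' <= e / 2], which fills up the [e / 2] spent in [est]. *)
  pose t := Num.min (d / 2) (e / (2 * (Q' + 1))).
  have q0 : 0 < 2 * (Q' + 1) by lra.
  have t0 : 0 < t by rewrite lt_min !divr_gt0.
  have td : t < d.
    by apply: (@le_lt_trans _ _ (d / 2)); rewrite /t ?ge_min ?lexx //; lra.
  have te : t * (2 * (Q' + 1)) <=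
    e by rewrite -ler_pdivlMr // /t ge_min lexx orbT.
  have := dE t; rewrite t0 td A0 sub0r normrN normrM (gtr0_norm t0) ler_pM2r //
    => /(_ isT).
  by lra.
exists b, V; split=> //.
  by move=> k; rewrite (_ : M / (1 - rho) ^+ 2 = Q) // /Q expr2 invfM mulrA.
rewrite wE A0 /=; apply/funext => k;
  rewrite mul0r add0r {1}WE convolDr convolZr.
by rewrite convol_delta0.
Qed.

(** In the [V] term associativity moves both differences onto the Poisson weights, where they gain
    the factor [2 / l]. The [b] term only uses that [diffseq] has l^1 norm 2; its smallness lies in
    [kappa]. *)
Lemma sum_convol_poisson_le (l M kappa : R) (w : nat -> R) (F : R -> R) N :
  0 < l ->
  (forall k, `|w k| <= M * rho ^+ k) ->
  (forall t, 0 < t < 1 -> (\sum_(k < N) w k * (1 - t) ^+ k) @[N --> \oo] --> F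
    t) ->
  (forall e, 0 < e -> exists2 d, 0 < d & forall t, 0 < t < d -> `|F t| <=
    (kappa + e) * t) ->
  \sum_(k < N) `|convol (poisson l) w k| <=
    2 * kappa + 2 / l * (M / (1 - rho) ^+ 3).
Proof.
move=> l0 wM cvF smallF; have l1 := ltW l0.
have [b [V [bk VM ->]]] := geometric_diff2 wM cvF smallF.
have M0 : 0 <= M by have := wM 0%N; rewrite mulr1; apply: le_trans.
have r1' : 0 < 1 - rho by rewrite subr_gt0; case/andP: rho01.
have step k : `|convol (poisson l)
  (fun k => b * diffseq k + convol diffseq (convol diffseq V) k) k|
   <= kappa * `|convol (poisson l) diffseq k| +
      `|convol (convol diffseq (convol diffseq (poisson l))) V k|.
  rewrite convolDr convolZr; apply: le_trans (ler_normD _ _) _.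
  rewrite normrM lerD ?ler_wpM2r //.
  by rewrite convolA (convolC (poisson l)) convolA -(convolC (convol _ _))
    -convolA.
apply: le_trans (ler_sum _ (fun (k : 'I_N) _ => step k)) _.
rewrite big_split /= -mulr_sumr; apply: lerD.
  rewrite mulrC ler_wpM2r ?(le_trans _ bk) //.
  apply: le_trans (sum_norm_convol _ _ _) _.
  rewrite -[leRHS]mul1r ler_pM ?sumr_ge0 //.
    under eq_bigr do rewrite ger0_norm ?poisson_ge0 //.
    exact: sum_poisson_le1.
  case: N => [|[|N]]; first by rewrite big_ord0.
    by rewrite big_ord1 /= normrN1 ler1n.
  rewrite !big_ord_recl /= normrN1 normr1 big1 ?addr0 // => i _.
  by rewrite /= normr0.
apply: le_trans (sum_norm_convol _ _ _) _.
rewrite ler_pM ?sumr_ge0 ?sum_diff2_poisson //.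
apply: (@le_trans _ _ (\sum_(k < N) M / (1 - rho) ^+ 2 * rho ^+ k)).
  exact: ler_sum.
apply: le_trans (sum_geometric_le rho01 _ _) _.
  by rewrite divr_ge0 ?exprn_ge0 // ltW.
by rewrite -mulrA -invfM -exprSr.
Qed.

End summation_by_parts.

(** * The real-valued modulus on [R[i]] *)

Section modulus.
Context {R : realType}.
Implicit Types (z w : R[i]) (x : R).

Lemma normc_ge0 z : 0 <= normc z.
Proof. by case: z => a b; exact: sqrtr_ge0. Qed.

Lemma normc_real x : normc x%:C = `|x|.
Proof. by rewrite /= expr0n addr0 sqrtr_sqr. Qed.

Lemma normcX z n : normc (z ^+ n) = normc z ^+ n.
Proof. by elim: n => [|n IH]; rewrite ?normc1 // !exprS normcM IH. Qed.

Lemma normcD z w : normc (z + w) <= normc z + normc w.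
Proof. exact: le_normcD. Qed.

Lemma normcB z w : normc (z - w) <= normc z + normc w.
Proof. by apply: le_trans (normcD _ _) _; rewrite normcN. Qed.

Lemma normc_sum I (r : seq I) (P : pred I) (f : I -> R[i]) :
  normc (\sum_(i <- r | P i) f i) <= \sum_(i <- r | P i) normc (f i).
Proof.
elim/big_ind2: _ => [|z x w y zx wy|i _] //; first by rewrite normc0.
exact: le_trans (normcD _ _) (lerD zx wy).
Qed.

Lemma normr_Re_le z : `|complex.Re z| <= normc z.
Proof.
case: z => a b /=; rewrite -sqrtr_sqr ler_wsqrtr // lerDl; exact: sqr_ge0.
Qed.

Lemma normr_Im_le z : `|complex.Im z| <= normc z.
Proof.
case: z => a b /=; rewrite -sqrtr_sqr ler_wsqrtr // lerDr; exact: sqr_ge0.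
Qed.

Lemma normc_le_ReIm z : normc z <= `|complex.Re z| + `|complex.Im z|.
Proof.
have -> : z = (complex.Re z)%:C + 'i * (complex.Im z)%:C.
  by case: z => a b; apply/eqP; rewrite eq_complex /=; apply/andP; split;
    apply/eqP; ring.
apply: le_trans (normcD _ _) _; rewrite normcM !normc_real.
have -> : normc 'i = 1 :> R by rewrite /= expr0n expr1n add0r sqrtr1.
by rewrite mul1r; case: z => a b /=;
  rewrite !(mul0r, mul1r, mulr0, addr0, subr0, add0r).
Qed.

End modulus.

(** * Complex series and the Cauchy product *)

Section complex_series.
Context {R : realType}.
Implicit Types (u v : nat -> R[i]) (l m s z w : R[i]).

(** Convergence is expressed through the real sequence of error moduli, so that the order and limit
    results over [R] apply. *)
Definition csum_cvg u l :=
  normc (l - \sum_(k < N) u k) @[N --> \oo] --> (0 : R).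

Lemma csum_cvg_le u l (b : nat -> R) :
  (forall N, normc (l - \sum_(k < N) u k) <= b N) ->
  b N @[N --> \oo] --> (0 : R) -> csum_cvg u l.
Proof.
move=> ub cb; apply: (@squeeze_cvgr _ _ _ _ (fun=> 0) b) => //;
  last exact: cvg_cst.
by apply: nearW => N; rewrite normc_ge0 ub.
Qed.

Lemma csum_cvgZ a u l : csum_cvg u l -> csum_cvg (fun k => a * u k) (a * l).
Proof.
move=> ul; apply: (@csum_cvg_le _ _
  (fun N => normc a * normc (l - \sum_(k < N) u k))).
  by move=> N; rewrite -mulr_sumr -mulrBr normcM.
by rewrite -[X in _ --> X](mulr0 (normc a)); apply: cvgMl_tmp.
Qed.

Lemma csum_cvg_eq u v l : u =1 v -> csum_cvg u l -> csum_cvg v l.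
Proof. by move/funext => ->. Qed.

Lemma ReD z w : complex.Re (z + w) = complex.Re z + complex.Re w.
Proof. by case: z w => [a b] [c d]. Qed.

Lemma Re_sum I (r : seq I) (f : I -> R[i]) :
  complex.Re (\sum_(i <- r) f i) = \sum_(i <- r) complex.Re (f i).
Proof. exact: (big_morph (@complex.Re R) (fun _ _ => ReD _ _) erefl). Qed.

Lemma csum_cvg_Re u l : csum_cvg u l ->
  \sum_(k < N) complex.Re (u k) @[N --> \oo] --> complex.Re l.
Proof.
move=> ul; apply/cvgrPdist_le => e e0; move/cvgrPdist_le: ul => /(_ e e0).
apply: filterS => N; rewrite sub0r normrN ger0_norm ?normc_ge0 //.
apply: le_trans; apply: le_trans (normr_Re_le _).
by rewrite -Re_sum; case: l (\sum_(k < N) u k) => [a b] [c d].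
Qed.

(** Mertens' argument under absolute convergence, with one [B] for both series: the product of
    partial sums exceeds the partial sum of the product by the pairs outside the triangle, whose
    moduli add up to [U N * V N - C N]. *)
Lemma csum_cvg_mul u v l m (B : R) :
  (forall N, \sum_(k < N) normc (u k) <= B) ->
  (forall N, \sum_(k < N) normc (v k) <= B) ->
  csum_cvg u l -> csum_cvg v m -> csum_cvg (convol u v) (l * m).
Proof.
move=> uB vB ul vm.
pose U N := \sum_(k < N) normc (u k); pose V N := \sum_(k < N) normc (v k).
pose nu k := normc (u k); pose nv k := normc (v k).
pose C N := \sum_(k < N) convol nu nv k.
have nd (w : nat -> R) : (forall k, 0 <= w k) ->
    nondecreasing_seq (fun N => \sum_(k < N) w k).
  by move=> w0; apply/nondecreasing_seqP => n; rewrite big_ord_recr lerDl.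
have ndU : nondecreasing_seq U by exact: (nd nu (fun k => normc_ge0 _)).
have ndV : nondecreasing_seq V by exact: (nd nv (fun k => normc_ge0 _)).
have ndC : nondecreasing_seq C.
  by apply: (nd (convol nu nv)) => k; apply: sumr_ge0 => i _;
    rewrite mulr_ge0 ?normc_ge0.
have U0 N : 0 <= U N by apply: sumr_ge0 => i _; exact: normc_ge0.
have V0 N : 0 <= V N by apply: sumr_ge0 => i _; exact: normc_ge0.
have CUV N : C N <= U N * V N.
  apply: (@le_trans _ _ (\sum_(k < N) `|convol nu nv k|)).
    by apply: ler_sum => k _; exact: ler_norm.
  apply: le_trans (sum_norm_convol _ _ _) _.
  by rewrite ler_pM ?sumr_ge0 //; apply: ler_sum => k _;
    rewrite ger0_norm ?normc_ge0.
have UVC N : U N * V N <= C (N + N)%N.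
  exact: (le_sum_convol N (fun k => normc_ge0 (u k))
    (fun k => normc_ge0 (v k))).
have cvU : cvgn U.
  by apply: nondecreasing_is_cvgn => //; exists B => _ [n _ <-]; exact: uB.
have cvV : cvgn V.
  by apply: nondecreasing_is_cvgn => //; exists B => _ [n _ <-]; exact: vB.
have cvC : cvgn C.
  apply: nondecreasing_is_cvgn => //; exists (B * B) => _ [n _ <-].
  by apply: le_trans (CUV n) _; rewrite ler_pM ?uB ?vB.
have cvUV : U N * V N @[N --> \oo] --> limn U * limn V by apply: cvgM.
(* The inequalities [C N <= U N * V N <= C (N + N)] force equal limits. *)
have limC : limn C = limn U * limn V.
  apply/eqP; rewrite eq_le; apply/andP; split.
    by apply: (ler_cvg_to cvC cvUV); apply: nearW.
  rewrite -(cvg_lim _ cvUV) //; apply: limr_le; first exact: cvgP cvUV.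
  apply: nearW => N; apply: le_trans (UVC N) _.
  exact: nondecreasing_cvgn_le.
have cv0 : U N * V N - C N @[N --> \oo] --> (0 : R).
  by rewrite -[X in _ --> X](subrr (limn C)) {1}limC; apply: cvgB.
pose d N := normc (l - \sum_(k < N) u k);
  pose e N := normc (m - \sum_(k < N) v k).
apply: (@csum_cvg_le _ _
  (fun N => normc l * e N + d N * normc m + d N * e N + (U N * V N - C N))).
  move=> N; set A := \sum_(k < N) u k; set A' := \sum_(k < N) v k.
  set S := \sum_(k < N) _.
  have -> : l * m - S = l * (m - A') + (l - A) * m - (l - A) * (m - A') +
    (A * A' - S).
    by ring.
  apply: le_trans (normcD _ _) _; apply: lerD.
    apply: le_trans (normcB _ _) _; rewrite normcM lerD2r.
    by apply: le_trans (normcD _ _) _; rewrite !normcM.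
  rewrite /S /C !convol_sum !mulr_suml -!sumrB.
  apply: le_trans (normc_sum _ _ _) _; apply: ler_sum => i _.
  rewrite !mulr_sumr [X in normc (X - _)](bigID (fun j : 'I_N => (i + j < N)%N))
    /=.
  rewrite [X in _ <= X - _](bigID (fun j : 'I_N => (i + j < N)%N)) /=.
  rewrite addrAC subrr add0r [leRHS]addrAC subrr add0r.
  apply: le_trans (normc_sum _ _ _) _; apply: ler_sum => j _.
  by rewrite normcM.
rewrite (_ : 0 = normc l * 0 + 0 * normc m + 0 * 0 + 0); last by ring.
apply: cvgD => //; apply: cvgD; last exact: cvgM.
by apply: cvgD; [apply: cvgMl_tmp | apply: cvgMr_tmp].
Qed.

End complex_series.

(** * The exponential series on [R[i]] *)

Section exponential.
Context {R : realType}.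
Implicit Types (z w : R[i]) (x y : R).

Lemma expCD z w : expC (z + w) = expC z * expC w.
Proof.
case: z w => [a b] [c d]; rewrite /expC /= expRD cosD sinD.
by apply/eqP; rewrite eq_complex /=; apply/andP; split; apply/eqP; ring.
Qed.

Lemma expC_real x : expC x%:C = (expR x)%:C.
Proof. by rewrite /expC /= cos0 sin0 mulr1 mulr0. Qed.

Lemma expC0 : expC (0 : R[i]) = 1.
Proof. by rewrite expC_real expR0. Qed.

Lemma natr_complex n : n%:R = (n%:R)%:C :> R[i].
Proof. by rewrite rmorph_nat. Qed.

Lemma exp_coeffC_real x k : x%:C ^+ k / k`!%:R = (x ^+ k / k`!%:R)%:C.
Proof. by rewrite natr_complex -rmorphXn -fmorphV -rmorphM. Qed.

Lemma exp_coeffC_imag y k :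
  ('i * y%:C) ^+ k / k`!%:R = (cos_coeff y k) +i* (sin_coeff y k) :> R[i].
Proof.
rewrite exprMn -mulrA exp_coeffC_real.
have -> : 'i ^+ k = ((~~ odd k)%:R * (-1) ^+ k./2) +i*
  ((odd k)%:R * (-1) ^+ k.-1./2) :> R[i].
  rewrite -{1}[k]odd_double_half exprD -muln2 mulnC exprM sqr_i.
  have -> : (-1 : R[i]) ^+ k./2 =
    ((-1) ^+ k./2)%:C by rewrite rmorphXn rmorphN1.
  case: (boolP (odd k)) => ko; rewrite ?mul1r ?mul0r.
    have -> : k.-1./2 = k./2 by rewrite -{1}[k]odd_double_half ko /= doubleK.
    by apply/eqP; rewrite eq_complex /=; apply/andP; split; apply/eqP; ring.
  by apply/eqP; rewrite eq_complex /=; apply/andP; split; apply/eqP; ring.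
apply/eqP; rewrite eq_complex /= /cos_coeff /sin_coeff /= -?exprnP.
by apply/andP; split; apply/eqP; ring.
Qed.

Lemma sum_norm_exp_coeffC_le z N :
  \sum_(k < N) normc (z ^+ k / k`!%:R) <= expR (normc z).
Proof.
apply: le_trans (sum_exp_coeff_le N (normc_ge0 z)).
apply: ler_sum => k _; rewrite normcM normcV normcX natr_complex normc_real.
by rewrite ger0_norm.
Qed.

(** On the real axis this is the real exponential series, on the imaginary axis the cosine and sine
    series; the Cauchy product with [convol_exp_coeff] joins the two. *)
Lemma csum_cvg_expC z : csum_cvg (fun k => z ^+ k / k`!%:R) (expC z).
Proof.
have real x : csum_cvg (fun k => x%:C ^+ k / k`!%:R) (expR x)%:C.
  have /cvgrPdist_le := @is_cvg_series_exp_coeff R x.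
  move=> cv; apply/cvgrPdist_le => e e0; have := cv e e0; apply: filterS => N.
  rewrite sub0r normrN (@ger0_norm _ (normc _)) ?normc_ge0 //.
  under eq_bigr do rewrite exp_coeffC_real.
  by rewrite -rmorph_sum -rmorphB normc_real /series /= big_mkord.
have imag y : csum_cvg (fun k => ('i * y%:C) ^+ k / k`!%:R) (cos y +i* sin y).
  have cc : cos y - series (cos_coeff y) N @[N --> \oo] --> (0 : R).
    rewrite -[X in _ --> X](subrr (cos y)); apply: cvgB; first exact: cvg_cst.
    by rewrite unlock; exact: is_cvg_series_cos_coeff.
  have ss : sin y - series (sin_coeff y) N @[N --> \oo] --> (0 : R).
    rewrite -[X in _ --> X](subrr (sin y)); apply: cvgB; first exact: cvg_cst.
    by rewrite unlock; exact: is_cvg_series_sin_coeff.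
  apply: (@csum_cvg_le _ _ _ (fun N => `|cos y - series (cos_coeff y) N| +
    `|sin y - series (sin_coeff y) N|)); last first.
    by rewrite -[X in _ --> X]addr0 -(normr0 R); apply: cvgD; apply: cvg_norm.
  move=> n; apply: le_trans (normc_le_ReIm _) _.
  have -> N : \sum_(k < N) ('i * y%:C) ^+ k / k`!%:R =
      series (cos_coeff y) N +i* series (sin_coeff y) N.
    elim: N => [|N IH]; first by rewrite big_ord0 /series /= !big_geq.
    rewrite big_ord_recr IH /= exp_coeffC_imag /series /= !big_nat_recr //=.
  by [].
case: z => x y.
have -> : x +i* y = x%:C + 'i * y%:C.
  by apply/eqP; rewrite eq_complex /=; apply/andP; split; apply/eqP; ring.
have -> : expC (x%:C + 'i * y%:C) = (expR x)%:C * (cos y +i* sin y).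
  rewrite expCD expC_real; congr (_ * _).
  by rewrite /expC /= !(mul0r, mul1r, subr0, add0r, mulr0, addr0) oppr0 expR0
    !mul1r.
have <- := convol_exp_coeff (x%:C : R[i]) ('i * y%:C).
apply: (@csum_cvg_mul _ _ _ _ _
  (expR (normc x%:C) + expR (normc ('i * y%:C)))) => // N.
  by apply: le_trans (sum_norm_exp_coeffC_le _ _) _; rewrite lerDl expR_ge0.
by apply: le_trans (sum_norm_exp_coeffC_le _ _) _; rewrite lerDr expR_ge0.
Qed.

End exponential.

(** * Cauchy's estimate by averaging over roots of unity *)

Section cauchy_estimate.
Context {R : realType}.
Implicit Types (c : nat -> R[i]) (r M : R).

(** Over the algebraically closed [R[i]] the separable polynomial ['X^n - 1] has [n] distinct roots,
    and such a full set of roots of unity contains a primitive one. *)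
Lemma prim_root_complex n : (0 < n)%N -> exists w : R[i], n.-primitive_root w.
Proof.
move=> n0.
have [rs rsE] := closed_field_poly_normal ('X^n - 1 : {poly R[i]}).
rewrite (monicP (monicXnsubC _ n0)) scale1r in rsE.
have Urs : uniq rs.
  by rewrite -separable_prod_XsubC -rsE separable_Xn_sub_1 // pnatr_eq0 -lt0n.
have szrs : size rs = n.
  by apply: succn_inj; rewrite -(size_prod_XsubC rs id) -rsE size_XnsubC.
have /has_prim_root : all n.-unity_root rs.
  by apply/allP => z zrs; rewrite /root_of_unity rsE root_prod_XsubC.
by move=> /(_ n0 Urs); rewrite szrs leqnn => /(_ isT)/hasP[w _ wP]; exists w.
Qed.

(** Averaging the values at [r w^i] against [w^(- i k)] isolates the coefficient of index [k], by
    orthogonality of the powers of [w]. The exponent [N - k] stands for [- k], since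
    [w ^+ N = 1]. *)
Lemma poly_cauchy_estimate c r M N k : 0 < r -> (k < N)%N ->
  (forall s, normc s = r -> normc (\sum_(j < N) c j * s ^+ j) <= M) ->
  normc (c k) * r ^+ k <= M.
Proof.
move=> r0 kN PM; have N0 : (0 < N)%N by apply: leq_trans kN.
have [w wP] := prim_root_complex N0.
have w1 : normc w = 1.
  apply/eqP; rewrite -(@pexpr_eq1 _ _ N) ?normc_ge0 // -normcX.
  by rewrite (prim_expr_order wP) normc1.
have sumw m : (m < N)%N ->
    \sum_(j < N) (w ^+ j) ^+ m * (w ^+ j) ^+ (N - k) =
      if m == k then N%:R else 0.
  move=> mN.
  under eq_bigr do rewrite -exprD -exprM mulnC exprM.
  case: eqVneq => [->|mk].
    rewrite subnKC ?(ltnW kN) // (prim_expr_order wP).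
    by under eq_bigr do rewrite expr1n; rewrite sumr_const card_ord.
  set x := w ^+ _.
  have x1 : x != 1.
    rewrite -(prim_order_dvd wP).
    have [km|mk'] := leqP k m.
      have -> : (m + (N - k) = (m - k) + N)%N by lia.
      rewrite dvdn_addl // gtnNdvd //; lia.
    by rewrite gtnNdvd //; lia.
  apply/eqP; have /eqP := subrX1 x N; rewrite /x -exprM mulnC exprM.
  rewrite (prim_expr_order wP) expr1n subrr eq_sym mulf_eq0 subr_eq0.
  by rewrite -/x (negbTE x1).
have key : \sum_(i < N) (\sum_(j < N) c j * (r%:C * w ^+ i) ^+ j) * (w ^+ i) ^+
  (N - k)
   = N%:R * (c k * r%:C ^+ k).
  under eq_bigr do rewrite mulr_suml.
  rewrite exchange_big /= (bigD1 (Ordinal kN)) //= [X in _ + X]big1 => [|j jk].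
    rewrite addr0; transitivity (\sum_(i < N) c k * r%:C ^+ k *
      ((w ^+ i) ^+ k * (w ^+ i) ^+ (N - k))).
      by apply: eq_bigr => i _; rewrite exprMn; ring.
    by rewrite -mulr_sumr sumw // eqxx mulrC.
  transitivity (\sum_(i < N) c j * r%:C ^+ j *
    ((w ^+ i) ^+ j * (w ^+ i) ^+ (N - k))).
    by apply: eq_bigr => i _; rewrite exprMn; ring.
  by rewrite -mulr_sumr sumw // -[nat_of_ord j == k]/(j == Ordinal kN)
    (negbTE jk) mulr0.
have N0' : 0 < N%:R :> R by rewrite ltr0n.
rewrite -(ler_pM2l N0').
have -> : N%:R * (normc (c k) * r ^+ k) = normc (N%:R * (c k * r%:C ^+ k)).
  by rewrite !normcM normcX natr_complex !normc_real (gtr0_norm r0) gtr0_norm.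
rewrite -key; apply: le_trans (normc_sum _ _ _) _.
rewrite mulr_natl -[N in leRHS]card_ord -sumr_const; apply: ler_sum => i _.
rewrite normcM !normcX w1 !expr1n mulr1; apply: PM.
by rewrite normcM normc_real normcX w1 expr1n mulr1 gtr0_norm.
Qed.

Lemma cauchy_estimate c (f : R[i] -> R[i]) r M B k : 0 < r ->
  (forall N, \sum_(j < N) normc (c j) * r ^+ j <= B) ->
  (forall s, normc s = r -> csum_cvg (fun j => c j * s ^+ j) (f s)) ->
  (forall s, normc s = r -> normc (f s) <= M) ->
  normc (c k) * r ^+ k <= M.
Proof.
move=> r0 cB cf fM; apply/ler_addgt0Pr => e e0.
pose S N := \sum_(j < N) normc (c j) * r ^+ j.
have t0 j : 0 <= normc (c j) * r ^+ j by rewrite mulr_ge0 ?normc_ge0 ?exprn_ge0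
  ?ltW.
have ndS : nondecreasing_seq S.
  by apply/nondecreasing_seqP => n; rewrite /S big_ord_recr lerDl.
have cvS : cvgn S.
  by apply: nondecreasing_is_cvgn => //; exists B => _ [n _ <-]; exact: cB.
have e2 : 0 < e / 2 by rewrite divr_gt0.
have /cvgrPdist_le/(_ _ e2)[N0 _ tail] := cvS.
(* [N] depends only on the tail of the absolute series, so the polynomial of length [N] is within
   [e] of [f] on the whole circle. The later [N'] depends on [s] and only links the partial sums to
   [f s]. *)
pose N := (maxn N0 k.+1).
apply: (@poly_cauchy_estimate c r _ N k) => //; first by rewrite leq_maxr.
move=> s sr; apply/ler_addgt0Pr => d d0.
have /cvgrPdist_le/(_ _ d0)[N1 _ near] := cf s sr.
pose N' := maxn N N1.
have := near N' (leq_maxr _ _); rewrite sub0r normrN ger0_norm ?normc_ge0 // =>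
  nr.
set P := \sum_(_ < _) _; set P' := \sum_(_ < _) _ in nr.
have PP : normc (P' - P) <= e.
  have NN' : (N <= N')%N by rewrite leq_maxl.
  have N0N : (N0 <= N)%N by rewrite leq_maxl.
  have tail_e n : (N0 <= n)%N -> `|limn S - S n| <= e / 2 by move=> /tail.
  apply: (@le_trans _ _ (S N' - S N)).
    rewrite /P' /P /S.
    rewrite -!(big_mkord xpredT (fun j => c j * s ^+ j)).
    rewrite -!(big_mkord xpredT (fun j => normc (c j) * r ^+ j)).
    rewrite !(@big_cat_nat _ _ _ N 0 N') //= ![_ + _ - _]addrAC !subrr !add0r.
    apply: le_trans (normc_sum _ _ _) _; apply: ler_sum => j _.
    by rewrite normcM normcX sr.
  have -> : S N' - S N = (limn S - S N) - (limn S - S N') by ring.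
  apply: le_trans (ler_norm _) _; apply: le_trans (ler_normB _ _) _.
  by rewrite [e]splitr lerD ?tail_e // (leq_trans N0N).
have -> : P = f s - (f s - P') - (P' - P) by ring.
apply: le_trans (normcB _ _) _; rewrite -addrA [e + d]addrC addrA lerD //.
by apply: le_trans (normcB _ _) _; rewrite lerD // fM.
Qed.

End cauchy_estimate.

(** * Removing the factor [s ^+ h] and the exponential from a generating function *)

Section factorisation.
Context {R : realType}.
Implicit Types (z s : R[i]) (x y : R).

Lemma csum_cvg_norm_le (u : nat -> R[i]) l (B : R) :
  csum_cvg u l -> (forall N, \sum_(k < N) normc (u k) <= B) -> normc l <= B.
Proof.
move=> ul uB; apply/ler_addgt0Pr => e e0.
have /cvgrPdist_le/(_ _ e0)[N _ /(_ N (leqnn _))] := ul.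
rewrite sub0r normrN ger0_norm ?normc_ge0 // => le_e.
have -> : l = \sum_(k < N) u k + (l - \sum_(k < N) u k) by ring.
apply: le_trans (normcD _ _) _; rewrite lerD //.
exact: le_trans (normc_sum _ _ _) (uB N).
Qed.

Lemma csum_cvg_real (u : nat -> R) l :
  csum_cvg (fun k => (u k)%:C) l -> complex.Im l = 0.
Proof.
move=> ul; apply/eqP; rewrite -normr_le0; apply/ler_addgt0Pr => e e0;
  rewrite add0r.
have /cvgrPdist_le/(_ _ e0)[N _ /(_ N (leqnn _))] := ul.
rewrite sub0r normrN ger0_norm ?normc_ge0 //; apply: le_trans.
apply: le_trans (normr_Im_le _); rewrite -rmorph_sum.
by case: l {ul} => a b /=; rewrite oppr0 addr0.
Qed.

Lemma normc_expC z : normc (expC z) = expR (complex.Re z).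
Proof.
rewrite /expC /= !exprMn -mulrDr cos2Dsin2 mulr1 sqrtr_sqr.
by rewrite ger0_norm ?expR_ge0.
Qed.

Lemma csum_cvg_poisson x s :
  csum_cvg (fun k => (poisson x k)%:C * s ^+ k) (expC (x%:C * (s - 1))).
Proof.
have -> : expC (x%:C * (s - 1)) = (expR (- x))%:C * expC (x%:C * s).
  rewrite -expC_real -expCD; congr expC.
  by rewrite rmorphN /= mulrBr mulr1 addrC.
apply: csum_cvg_eq (csum_cvgZ _ (csum_cvg_expC _)) => k.
by rewrite /poisson exprMn rmorphM /= -exp_coeffC_real; ring.
Qed.

Lemma sum_norm_poisson_le x y N : 0 <= y ->
  \sum_(k < N) `|poisson x k| * y ^+ k <= expR (- x) * expR (`|x| * y).
Proof.
move=> y0; apply: le_trans (ler_wpM2l (expR_ge0 _) (sum_exp_coeff_le N _));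
  last first.
  by rewrite mulr_ge0.
rewrite mulr_sumr; apply: ler_sum => k _;
  rewrite /poisson normrM ger0_norm ?expR_ge0 //.
rewrite -mulrA ler_wpM2l ?expR_ge0 // normrM normfV normrX exprMn.
by rewrite (@ger0_norm _ k`!%:R) ?ler0n // mulrAC.
Qed.

(** With nonnegative coefficients one term is at most the whole sum: [p k * r ^+ k] is bounded by a
    multiple of [r ^+ h] at small [r > 0]. Since [r <= 1] and [k < h], dividing gives
    [p k <= |B| r]. *)
Lemma vanishing_coeffs (p : nat -> R) (f : R[i] -> R[i]) (eta d B : R) h :
  (forall k, 0 <= p k) -> 0 < eta -> 0 < d ->
  (forall s, normc s < eta -> csum_cvg (fun k => (p k)%:C * s ^+ k) (f s)) ->
  (forall s, normc s < d -> normc (f s) <= B * normc s ^+ h) ->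
  forall k, (k < h)%N -> p k = 0.
Proof.
move=> p0 eta0 d0 pf fB k kh.
pose r0 := Num.min (Num.min (d / 2) (eta / 2)) 1.
have r00 : 0 < r0 by rewrite !lt_min ltr01 !divr_gt0.
have small r : 0 < r <= r0 -> p k <= `|B| * r.
  case/andP=> rpos; rewrite !le_min => /andP[/andP[rd reta] r1].
  have nr : normc r%:C = r by rewrite normc_real gtr0_norm.
  have pr : p k * r ^+ k <= complex.Re (f r%:C).
    have /csum_cvg_Re cv : csum_cvg (fun k => (p k)%:C * r%:C ^+ k) (f r%:C).
      by apply: pf; rewrite nr; lra.
    apply: (ler_cvg_to (cvg_cst (p k * r ^+ k)) cv); exists k.+1 => // N /= kN.
    rewrite (bigD1 (Ordinal kN)) //= -rmorphXn -rmorphM lerDl sumr_ge0 // =>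
      i _.
    by rewrite -rmorphXn -rmorphM mulr_ge0 ?p0 ?exprn_ge0 ?ltW.
  have fr : complex.Re (f r%:C) <= `|B| * r ^+ h.
    apply: le_trans (ler_norm _) _; apply: le_trans (normr_Re_le _) _.
    have := fB r%:C; rewrite nr => /(_ ltac:(lra)) /le_trans; apply.
    by rewrite ler_wpM2r ?exprn_ge0 ?ler_norm ?ltW.
  rewrite -(@ler_pM2r _ (r ^+ k)) ?exprn_gt0 //; apply: le_trans pr _.
  apply: le_trans fr _; rewrite -mulrA -exprS ler_wpM2l //.
  by rewrite ler_wiXn2l // ltW.
apply/eqP; rewrite eq_le p0 andbT; apply/ler_addgt0Pr => e e0; rewrite add0r.
pose r := Num.min r0 (e / (`|B| + 1)).
have B1 : 0 < `|B| + 1 by rewrite ltr_wpDl.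
have rpos : 0 < r by rewrite lt_min r00 divr_gt0.
apply: le_trans (small r _) _; first by rewrite rpos ge_min lexx.
apply: (@le_trans _ _ ((`|B| + 1) * r)); first by rewrite ler_pM2r // lerDl.
by rewrite mulrC -ler_pdivlMr // ge_min lexx orbT.
Qed.

Lemma csum_cvg_shift (u : nat -> R) s l h : s != 0 ->
  (forall k, (k < h)%N -> u k = 0) ->
  csum_cvg (fun k => (u k)%:C * s ^+ k) (s ^+ h * l) ->
  csum_cvg (fun k => (u (k + h)%N)%:C * s ^+ k) l.
Proof.
move=> s0 u0 ul; have sh : s ^+ h != 0 by rewrite expf_neq0.
have ns : normc (s ^+ h) != 0 by apply: contra sh => /eqP/eq0_normc ->.
have E N : normc (l - \sum_(k < N) (u (k + h)%N)%:C * s ^+ k) =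
    (normc (s ^+ h))^-1 * normc (s ^+ h * l - \sum_(k < N + h) (u k)%:C * s ^+
      k).
  apply: (mulfI ns); rewrite mulVKf // -normcM mulrBr; congr (normc (_ - _)).
  rewrite -(big_mkord xpredT (fun k => (u k)%:C * s ^+ k))
    (@big_cat_nat _ _ _ h) ?leq_addl //=.
  rewrite [X in X + _]big_nat_cond [X in X + _]big1 ?add0r; last first.
    by move=> i /andP[/andP[_ ih] _]; rewrite u0 // mul0r.
  rewrite (big_addn 0 (N + h) h) addnK big_mkord mulr_sumr; apply: eq_bigr =>
    k _.
  by rewrite exprD; ring.
apply: (@csum_cvg_le _ _ _ (fun N => (normc (s ^+ h))^-1 *
  normc (s ^+ h * l - \sum_(k < N + h) (u k)%:C * s ^+ k))); first by move=> N;
    rewrite E.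
rewrite -[X in _ --> X](mulr0 (normc (s ^+ h))^-1); apply: cvgMl_tmp.
by have := ul; rewrite /csum_cvg -(cvg_shiftn h).
Qed.

(** Convolving the shifted [p] with [poisson (- l)] inverts the exponential factor, and the Cauchy
    product identifies the result with [H]. The point 0 is excluded because of the division by
    [s ^+ h]. *)
Lemma factor_coeffs (p : nat -> R) (H : R[i] -> R[i]) (l eta d B : R) h :
  0 <= l -> 1 < eta -> 0 < d -> (forall k, 0 <= p k) ->
  (forall s, normc s < eta ->
     csum_cvg (fun k => (p k)%:C * s ^+ k)
       (expC (l%:C * (s - 1)) * s ^+ h * H s)) ->
  (forall s, normc s < d -> normc (H s) <= B) ->
  exists c : nat -> R,
  [/\ forall s, 0 < normc s < eta ->
    csum_cvg (fun k => (c k)%:C * s ^+ k) (H s),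
      convol (poisson l) c = (fun k => p (k + h)%N) &
      forall r, 0 < r < eta -> exists B', forall N,
        \sum_(k < N) `|c k| * r ^+ k <= B'].
Proof.
move=> l0 eta1 d0 p0 pH HB; have eta0 : 0 < eta by apply: lt_trans eta1.
have pk0 : forall k, (k < h)%N -> p k = 0.
  pose d' := Num.min d 1.
  apply: (@vanishing_coeffs p _ eta d' B h p0 eta0 _ pH);
    first by rewrite lt_min d0 ltr01.
  (* For [|s| < 1] the real part of [l (s - 1)] is at most 0, so the exponential has modulus at most
     1. *)
  move=> s; rewrite lt_min => /andP[sd s1].
  rewrite !normcM normc_expC normcX mulrAC ler_wpM2r ?exprn_ge0 ?normc_ge0 //.
  rewrite -[leRHS]mul1r ler_pM ?expR_ge0 ?normc_ge0 ?HB // -expR0 ler_expR.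
  have : complex.Re s <= 1.
    by apply: le_trans (ltW s1); apply: le_trans (normr_Re_le _);
      exact: ler_norm.
  case: s {sd s1} => a b /= a1; rewrite mul0r subr0.
  by rewrite mulr_ge0_le0 // subr_le0.
pose q k := p (k + h)%N; exists (convol (poisson (- l)) q).
have qH s : 0 < normc s < eta ->
    csum_cvg (fun k => (q k)%:C * s ^+ k) (expC (l%:C * (s - 1)) * H s).
  case/andP=> s0 seta; apply: csum_cvg_shift pk0 _.
    by apply: contraTneq s0 => ->; rewrite normc0 ltxx.
  by have := pH s seta; rewrite mulrCA mulrA.
(* As [q] is nonnegative, convergence at the real point [r] is absolute, and the limit bounds all
   partial sums. *)
have qB r : 0 < r < eta -> exists B', forall N, \sum_(k < N) q k * r ^+ k <= B'.
  case/andP=> r0 reta; have := qH r%:C; rewrite normc_real gtr0_norm // r0 reta.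
  move=> /(_ isT)/csum_cvg_Re.
  set L := complex.Re _ => cv; exists L => N.
  have {}cv : \sum_(k < N) q k * r ^+ k @[N --> \oo] --> L.
    move: cv; rewrite (_ : (fun N : nat => _) =
      (fun N => \sum_(k < N) q k * r ^+ k)) //.
    by apply/funext => M; apply: eq_bigr => k _; rewrite -rmorphXn -rmorphM.
  rewrite -(cvg_lim _ cv) //.
  apply: (@nondecreasing_cvgn_le _ (fun N => \sum_(k < N) q k * r ^+ k)).
    apply/nondecreasing_seqP => n; rewrite big_ord_recr lerDl.
    by rewrite mulr_ge0 ?p0 ?exprn_ge0 ?ltW.
  exact: cvgP cv.
have pB r : 0 < r < eta -> exists B', forall N,
  \sum_(k < N) `|poisson (- l) k| * r ^+ k <= B'.
  case/andP=> r0 _; exists (expR (- - l) * expR (`|- l| * r)) => N.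
  exact/sum_norm_poisson_le/ltW.
split=> [s sr||r rr].
- have [B1 B1P] := qB _ sr; have [B2 B2P] := pB _ sr.
  have B10 : 0 <= B1 by have := B1P 0%N; rewrite big_ord0.
  have B20 : 0 <= B2 by have := B2P 0%N; rewrite big_ord0.
  have -> : H s = expC ((- l)%:C * (s - 1)) * (expC (l%:C * (s - 1)) * H s).
    rewrite mulrA -expCD (_ : _ + _ = 0) ?expC0 ?mul1r // -mulrDl -rmorphD /=.
    by rewrite addNr mul0r.
  apply: (csum_cvg_eq _ (csum_cvg_mul (B := B1 + B2) _ _
    (csum_cvg_poisson (- l) s) (qH s sr))) => [k|N|N].
  + rewrite convol_geometric; congr (_ * _); rewrite /convol rmorph_sum.
    by apply: eq_bigr => i _; rewrite -rmorphM.
  + apply: le_trans (_ : B2 <= _); last by rewrite lerDr.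
    apply: le_trans (B2P N); apply: ler_sum => k _.
    by rewrite normcM normcX normc_real.
  + apply: le_trans (_ : B1 <= _); last by rewrite lerDl.
    apply: le_trans (B1P N); apply: ler_sum => k _.
    by rewrite normcM normcX normc_real ger0_norm // p0.
- by rewrite convolA convol_poisson subrr poisson0 convolC convol_delta0.
- have [B1 B1P] := qB _ rr; have [B2 B2P] := pB _ rr.
  have r0 : 0 <= r by case/andP: rr => /ltW.
  exists (B2 * B1) => N.
  have -> : \sum_(k < N) `|convol (poisson (- l)) q k| * r ^+ k =
     \sum_(k < N) `|convol (fun k => poisson (- l) k * r ^+ k)
       (fun k => q k * r ^+ k) k|.
    apply: eq_bigr => k _; rewrite convol_geometric normrM.
    by rewrite [X in _ = _ * X]ger0_norm ?exprn_ge0.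
  apply: le_trans (sum_norm_convol _ _ _) _.
  rewrite ler_pM ?sumr_ge0 //.
    apply: le_trans (B2P N); apply: ler_sum => k _.
    by rewrite normrM (ger0_norm (exprn_ge0 _ r0)).
  apply: le_trans (B1P N); apply: ler_sum => k _.
  by rewrite ger0_norm // mulr_ge0 ?p0 ?exprn_ge0.
Qed.

End factorisation.

(** * First-order expansions *)

Section derivatives.
Context {R : realType}.

(** Differentiability rewritten with real moduli: a positive element of [R[i]] is real, which makes
    the radius real. The increment 0, where the difference quotient says nothing, is checked
    apart. *)
Lemma derivable_expansion (f : R[i]^o -> R[i]^o) (z : R[i]) (e : R) :
  derivable f z 1 -> 0 < e ->
  exists2 d : R, 0 < d & forall t : R[i], normc t < d ->
    normc (f (z + t) - f z - t * derive1 f z) <= e * normc t.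
Proof.
move=> df e0.
have eC : 0 < e%:C :> R[i] by rewrite ltcR.
have /cvgrPdist_le/(_ _ eC) := df.
case/nbhs_ballP => d /= d0 dP.
have [dr dE] : exists dr : R, d = dr%:C.
  by apply/complex_realP; rewrite realE ltW.
exists dr; first by rewrite -ltcR -dE.
move=> t td; have [->|t0] := eqVneq t 0.
  by rewrite addr0 subrr mul0r subr0 normc0 mulr0.
have /= := dP t; rewrite /ball /= sub0r normrN dE => /(_ _ t0).
have -> : `|t| = (normc t)%:C by [].
rewrite ltcR => /(_ td).
rewrite derive1E.
set D := 'D_1 f z.
rewrite -[lim _]/D -[t%:A]/(t * 1) mulr1 [t + z]addrC -[_ *: _]/(t^-1 * _).
set q := D - _; rewrite -[`|q|]/((normc q)%:C) lecR => qe.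
have -> : f (z + t) - f z - t * D = - (t * q) by rewrite /q mulrBr mulVKf //;
  ring.
by rewrite normcN normcM mulrC ler_wpM2r ?normc_ge0.
Qed.

(** The inequality [1 + y <= expR y] at [x] gives the lower bound; at [- x] it gives
    [expR x * (1 - x) <= 1], hence the upper one. *)
Lemma expR_taylor1 (x : R) : `|x| <= 1 / 2 -> `|expR x - 1 - x| <= 2 * x ^+ 2.
Proof.
rewrite ler_norml => /andP[x1 x2].
have l1 := expR_ge1Dx x; have l2 := expR_ge1Dx (- x).
have E : expR x * expR (- x) = 1 by exact: expRxMexpNx_1.
have e0 := expR_gt0 x.
have u : expR x <= 1 + x + 2 * x ^+ 2.
  have y0 : 0 < 1 - x by lra.
  rewrite -(ler_pM2r y0); apply: (@le_trans _ _ 1).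
    by rewrite -[leRHS]E ler_wpM2l // ltW.
  by nra.
by rewrite ler_norml; apply/andP; split; have := sqr_ge0 x; lra.
Qed.

End derivatives.

(** * The Poisson approximation bound for real coefficients *)

Section approximation.
Context {R : realType}.

Lemma geometric_bound (r M x : R) k : 0 < r -> `|x| * r ^+ k <= M ->
  `|x| <= M * r^-1 ^+ k.
Proof. by move=> r0 xM; rewrite exprVn ler_pdivlMr ?exprn_gt0. Qed.

(* [G t] and [E t] stand for g and eps_n at the point 1 - t of the real axis. *)
Lemma sum_poisson_approx_le (l K M r a : R) (c : nat -> R) (G E : R -> R[i]) N :
  0 < l -> 1 < r ->
  (forall k, `|c k| * r ^+ k <= M) ->
  (forall t, 0 < t < 1 -> csum_cvg (fun k => (c k)%:C * (1 - t)%:C ^+ k)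
    (G t + E t)) ->
  (forall e, 0 < e -> exists2 d, 0 < d &
     forall t, 0 < t < d -> normc (G t - 1 + t%:C * a%:C) <= e * t) ->
  (forall t, 0 < t < 1 -> normc (E t) <= K / l * t) ->
  \sum_(k < N) `|convol (poisson l) c k - poisson (l + a) k| <=
    (2 * K + 2 * ((M + expR (- a) * expR (`|a| * r)) / (1 - r^-1) ^+ 3)) / l.
Proof.
move=> l0 r1 cM cH Gd EK; have r0 : 0 < r by apply: lt_trans r1.
have rho01 : 0 < r^-1 < 1 by rewrite invr_gt0 r0 invf_lt1.
set Mq := expR (- a) * _.
have qM k : `|poisson a k| * r ^+ k <= Mq.
  apply: le_trans (sum_norm_poisson_le a k.+1 (ltW r0)).
  rewrite big_ord_recr /= lerDr sumr_ge0 // => i _.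
  by rewrite mulr_ge0 ?exprn_ge0 // ltW.
pose w k := c k - poisson a k.
have wM k : `|w k| <= (M + Mq) * r^-1 ^+ k.
  apply: geometric_bound => //; apply: le_trans
    (_ : (`|c k| + `|poisson a k|) * r ^+ k <= _).
    by rewrite ler_wpM2r ?ler_normB // exprn_ge0 // ltW.
  by rewrite mulrDl lerD.
(* The generating function of [w] at [1 - t]; since [w] is real, the real part loses nothing. *)
pose F t := complex.Re (G t + E t) - expR (- (a * t)).
have cvF t : 0 < t < 1 -> (\sum_(k < n) w k * (1 - t) ^+ k) @[n --> \oo] --> F
  t.
  move=> t01; have /csum_cvg_Re c1 := cH t t01.
  have /csum_cvg_Re c2 := csum_cvg_poisson a (1 - t)%:C.
  have -> : F t = complex.Re (G t + E t) - complex.Re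
    (expC (a%:C * ((1 - t)%:C - 1))).
    rewrite /F; congr (_ - _).
    have -> : a%:C * ((1 - t)%:C - 1) = (- (a * t))%:C.
      have -> : (1 - t)%:C - 1 = (- t)%:C.
        by apply/eqP; rewrite eq_complex /=; apply/andP; split; apply/eqP; ring.
      by rewrite -rmorphM mulrN.
    by rewrite expC_real.
  rewrite [X in X n @[n --> _] --> _](_ : _ = (fun n =>
    \sum_(k < n) complex.Re ((c k)%:C * (1 - t)%:C ^+ k) -
    \sum_(k < n) complex.Re ((poisson a k)%:C * (1 - t)%:C ^+ k)));
      first exact: cvgB.
  apply/funext => n; rewrite -sumrB; apply: eq_bigr => k _.
  by rewrite /w mulrBl -!rmorphXn -!rmorphM.
(* [G t] and [expR (- (a * t))] share the expansion [1 - a t] up to [o(t)], so [E] alone contributes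
   at first order, with slope at most [K / l]. *)
have smallF e : 0 < e -> exists2 d, 0 < d & forall t, 0 < t < d ->
    `|F t| <= (K / l + e) * t.
  move=> e0; have e2 : 0 < e / 2 by rewrite divr_gt0.
  have [d d0 dG] := Gd _ e2.
  have B0 : 0 < `|a| + 1 by rewrite ltr_wpDl.
  (* The third entry ensures [|a t| <= 1 / 2] for [expR_taylor1], the fourth turns its bound
     [2 (a t)^2] into at most [e t / 2]. *)
  pose d' := Num.min (Num.min d 1)
    (Num.min ((2 * (`|a| + 1))^-1) (e / (4 * (`|a| + 1) ^+ 2))).
  exists d'.
    by rewrite !lt_min d0 ltr01 invr_gt0 divr_gt0 ?mulr_gt0 ?exprn_gt0.
  move=> t /andP[t0]; rewrite !lt_min => /andP[/andP[td t1] /andP[tB te]].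
  have t01 : 0 < t < 1 by rewrite t0.
  have := dG t; rewrite t0 td => /(_ isT) /(le_trans (normr_Re_le _)) bG.
  have /(le_trans (normr_Re_le _)) bE := EK t t01.
  have at_le : `|a| * t <= (`|a| + 1) * t by rewrite ler_pM2r // lerDl.
  have bx : `|expR (- (a * t)) - 1 - - (a * t)| <= e / 2 * t.
    apply: le_trans (expR_taylor1 _) _.
      rewrite normrN normrM (gtr0_norm t0); apply: le_trans at_le _.
      rewrite mulrC -ler_pdivlMr // ltW //; apply: lt_le_trans tB _.
      by rewrite invfM div1r.
    rewrite sqrrN exprMn -(real_normK (num_real a)).
    have : (`|a|) ^+ 2 * t ^+ 2 <= (`|a| + 1) ^+ 2 * t * t.
      rewrite -mulrA -expr2 -!exprMn lerXn2r // nnegrE mulr_ge0 ?addr_ge0 //.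
        exact: ltW.
      exact: ltW.
    move: te; rewrite ltr_pdivlMr ?mulr_gt0 ?exprn_gt0 // => te h1.
    have : t * (4 * (`|a| + 1) ^+ 2) * t <= e * t by rewrite ler_pM2r // ltW.
    by lra.
  have ReG : complex.Re (G t - 1 + t%:C * a%:C) = complex.Re (G t) - 1 + a * t.
    by case: (G t) => u v /=; ring.
  have -> : F t = (complex.Re (G t) - 1 + a * t) + complex.Re (E t)
      - (expR (- (a * t)) - 1 - - (a * t)).
    by rewrite /F ReD; ring.
  rewrite -ReG; apply: le_trans (ler_normB _ _) _.
  apply: le_trans (lerD (ler_normD _ _) (lexx _)) _.
  by lra.
have := sum_convol_poisson_le rho01 N l0 wM cvF smallF.
rewrite (eq_bigr (fun k : 'I_N =>
  `|convol (poisson l) c k - poisson (l + a) k|)); last first.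
  by move=> k _; rewrite convolBr convol_poisson.
move/le_trans; apply; rewrite le_eqVlt; apply/orP; left; apply/eqP; ring.
Qed.

(** Clearing the denominator gives a usable real inequality. The maximum with 0 makes [K]
    nonnegative and also covers the value [-oo] of an empty supremum. *)
Lemma Ksup_bound (lam : nat -> R) (eps : nat -> R[i] -> R[i]) (delta : R) :
  (Ksup lam eps delta < +oo)%E -> exists2 K, 0 <= K &
  forall n s, (0 < n)%N -> 0 < normc (s - 1) < delta ->
    lam n * normc (eps n s) <= K * normc (s - 1).
Proof.
move=> Kfin; pose K := Num.max 0 (fine (Ksup lam eps delta)).
have KK : (Ksup lam eps delta <= K%:E)%E.
  move: Kfin; rewrite /K; case: Ksup => [x| |] //=; last by rewrite leNye.
  by rewrite lee_fin le_max lexx orbT.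
exists K; first by rewrite le_max lexx.
move=> n s n0 s1; have /andP[s0 _] := s1; rewrite -ler_pdivrMr // -mulrA.
rewrite -normcV -normcM -lee_fin; apply: le_trans KK.
apply: (@le_trans _ _ (ereal_sup [set (lam n * normc (eps n s / (s - 1)))%:E
  | s in [set s : R[i] | 0 < normc (s - 1) < delta]])).
  by apply: ereal_sup_ubound; exists s.
by apply: ereal_sup_ubound; exists n.
Qed.

Lemma cvgn_csum (u : nat -> R[i]^o) :
  cvgn [series u k]_k -> csum_cvg u (limn [series u k]_k).
Proof.
move=> cu; apply/cvgrPdist_le => e e0.
have eC : 0 < e%:C :> R[i] by rewrite ltcR.
have /cvgrPdist_le/(_ _ eC) := cu; apply: filterS => N.
rewrite -[`|_|]/((normc _)%:C) lecR sub0r normrN ger0_norm ?normc_ge0 //.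
by rewrite /series /= big_mkord.
Qed.

End approximation.

(** * Application to the given random variables *)

Theorem proposition2 (R : realType)
    (d : nat -> measure_display) (T : forall n, measurableType (d n))
    (P : forall n, probability (T n) R) (X : forall n, {RV (P n) >-> nat})
    (eta : R) (tau : nat -> R) (lam : nat -> R) (h : nat)
    (g : nat -> R[i]^o -> R[i]^o) (eps : nat -> R[i]^o -> R[i]^o)
    (eta_gt3 : 3 < eta)
    (tau_gt0 : forall n, (0 < n)%N -> 0 < tau n)
    (pgf_hol : forall n, (0 < n)%N ->
       pgf_holomorphic_in (disc 0 (eta + tau n)) (X n))
    (pgfE : forall n, (0 < n)%N -> forall s, disc 0 (eta + tau n) s ->
       pgf (X n) s = expC ((lam n)%:C * (s - 1)) * s ^+ h * (g n s + eps n s))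
    (lam_gt0 : forall n, (0 < n)%N -> 0 < lam n)
    (lam_div : lam n @[n --> \oo] --> +oo)
    (g_indep : forall m n, (0 < m)%N -> (0 < n)%N ->
       forall s, disc 0 eta s -> g m s = g n s)
    (g_hol : forall n, (0 < n)%N -> holomorphic_in (disc 0 eta) (g n))
    (g_1 : forall n, (0 < n)%N -> g n 1 = 1)
    (g_0 : forall n, (0 < n)%N -> g n 0 != 0)
    (eps_hol : forall n, (0 < n)%N -> holomorphic_in (disc 0 eta) (eps n))
    (K_fin : (Ksup lam eps (eta - 1) < +oo)%E) :
  exists (n0 : nat) (C : R), (0 < n0)%N /\ 0 < C /\
    forall n, (n0 <= n)%N ->
      let mu := (lam n)%:C + derive1 (g n) 1 in
      (\sum_(h <= k <oo)
         (Normc.normc ((pr_eq (X n) k)%:C -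
                 expC (- mu) * (mu ^+ (k - h) / ((k - h)`!)%:R)))%:E
       <= (C / lam n)%:E)%E.
Proof.
have [K K0 KP] := Ksup_bound K_fin.
(* The midpoint of 1 and [eta - 2]; [eta > 3] gives both [1 < r] and [r + 1 < eta - 1]. *)
pose r := (eta - 1) / 2.
have r1 : 1 < r by rewrite /r; lra.
have r_eta : r + 1 < eta - 1 by rewrite /r; lra.
have r0 : 0 < r by lra.
have eta0 : 0 < eta by lra.
have one_disc t : 0 < t < 1 -> normc (1 - t)%:C < eta.
  by move=> /andP[t0 t1]; rewrite normc_real gtr0_norm ?subr_gt0 //; lra.
have in_disc (s : R[i]) : normc s < eta ->
  disc 0 eta s by rewrite /disc /= subr0.
have gE m n (s : R[i]) : (0 < m)%N -> (0 < n)%N -> normc s < eta -> g m s =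
  g n s.
  by move=> m0 n0 /in_disc; exact: g_indep.
have epsE n s : (0 < n)%N -> 0 < normc (s - 1) < eta - 1 ->
    normc (eps n s) <= K / lam n * normc (s - 1).
  move=> n0 s1; rewrite mulrAC ler_pdivlMr ?lam_gt0 // mulrC.
  exact: KP.
have eps_t n t : (0 < n)%N -> 0 < t < 1 -> normc (eps n (1 - t)%:C) <=
  K / lam n * t.
  move=> n0 /andP[t0 t1].
  have E : normc ((1 - t)%:C - 1 : R[i]) = t.
    have -> : (1 - t)%:C - 1 = (- t)%:C :> R[i].
      by apply/eqP; rewrite eq_complex /=; apply/andP; split; apply/eqP; ring.
    by rewrite normc_real normrN gtr0_norm.
  by rewrite -[X in _ <= _ * X]E; apply: epsE => //; rewrite E t0; lra.
(* Near 0, [g n] is bounded by differentiability and [eps n] by [K_fin], as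
   [|s - 1| <= 2 < eta - 1]. These bounds may depend on [n]: they only serve [factor_coeffs]. *)
have bounded_H n : (0 < n)%N -> exists2 d, 0 < d & exists B, forall s,
  normc s < d ->
    normc (g n s + eps n s) <= B.
  move=> n0; have dg : derivable (g n) 0 1 by apply: g_hol => //;
    apply: in_disc; rewrite normc0.
  have [del d0 dP] := derivable_expansion dg ltr01.
  exists (Num.min del (1 / 2)); first by rewrite lt_min d0; lra.
  exists (normc (g n 0) + 1 + normc (derive1 (g n) 0) + K / lam n * 2) => s.
  rewrite lt_min => /andP[sd s1].
  apply: le_trans (normcD _ _) _; apply: lerD.
    have := dP s sd; rewrite add0r mul1r => bs.
    have -> : g n s = g n 0 + (g n s - g n 0 - s * derive1 (g n) 0) + s *
      derive1 (g n) 0 by ring.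
    apply: le_trans (normcD _ _) _; apply: lerD.
      apply: le_trans (normcD _ _) _; rewrite lerD2l; apply: le_trans bs _; lra.
    by rewrite normcM ler_piMl ?normc_ge0 //; lra.
  have up : normc (s - 1) <= 2.
    by apply: le_trans (normcB _ _) _; rewrite normc1; lra.
  have low : 0 < normc (s - 1).
    have := normcB s (s - 1); have -> : s - (s - 1) = 1 by ring.
    by rewrite normc1; lra.
  apply: le_trans (epsE n s n0 _) _; first by rewrite low; lra.
  by rewrite ler_wpM2l // divr_ge0 // ltW ?lam_gt0.
have coeffs n : (0 < n)%N -> exists c : nat -> R,
  [/\ forall s, 0 < normc s < eta ->
    csum_cvg (fun k => (c k)%:C * s ^+ k) (g n s + eps n s),
      convol (poisson (lam n)) c = (fun k => pr_eq (X n) (k + h)%N) &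
      forall r, 0 < r < eta -> exists B', forall N,
        \sum_(k < N) `|c k| * r ^+ k <= B'].
  move=> n0; have [del d0 [B HB]] := bounded_H n n0.
  apply: (@factor_coeffs _ (pr_eq (X n)) (fun s => g n s + eps n s) (lam n) eta
    del B h) => //.
  - by rewrite ltW ?lam_gt0.
  - by lra.
  - by move=> k; rewrite fine_ge0.
  - move=> s s_eta; have sD : disc 0 (eta + tau n) s.
      by rewrite /disc /= subr0; apply: lt_trans s_eta _; rewrite ltrDl tau_gt0.
    rewrite -pgfE //; have [cv _] := pgf_hol n n0; exact: cvgn_csum (cv s sD).
(* On the circle, the function of index 1 is bounded by the sum of its own absolutely convergent
   expansion. *)
have [B1 B1P] : exists B1, forall s, normc s = r ->
  normc (g 1%N s + eps 1%N s) <= B1.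
  have [c [cH _ cB]] := coeffs 1%N isT.
  have [|B1 B1P] := cB r; first by rewrite r0 /r; lra.
  exists B1 => s sr; apply: (csum_cvg_norm_le (cH s _)) => [|N].
    by rewrite sr r0 /r; lra.
  apply: le_trans (B1P N); apply: ler_sum => k _.
  by rewrite normcM normcX normc_real sr.
(* Since [g] is independent of the index, [H_n = H_1 - eps_1 + eps_n]; each summand of [M] bounds
   one of these, the last one using [lam n >= 1]. *)
pose M := B1 + K / lam 1%N * (r + 1) + K * (r + 1).
have HM n s : (0 < n)%N -> 1 <= lam n -> normc s = r ->
  normc (g n s + eps n s) <= M.
  move=> n0 ln sr.
  have s_eta : normc s < eta by rewrite sr /r; lra.
  have up : normc (s - 1) <= r + 1.
    by apply: le_trans (normcB _ _) _; rewrite normc1 sr.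
  have low : 0 < normc (s - 1).
    have := normcB s (s - 1); have -> : s - (s - 1) = 1 by ring.
    have := normcD (s - 1) 1; have -> : s - 1 + 1 = s by ring.
    by rewrite normc1 sr; lra.
  have -> : g n s + eps n s = g 1%N s + eps 1%N s - eps 1%N s + eps n s.
    by rewrite addrK (gE n 1%N).
  apply: le_trans (normcD _ _) _; apply: lerD.
    apply: le_trans (normcB _ _) _; apply: lerD; first exact: B1P.
    apply: le_trans (epsE 1%N s isT _) _; first by rewrite low; lra.
    by rewrite ler_wpM2l // divr_ge0 // ltW ?lam_gt0.
  apply: le_trans (epsE n s n0 _) _; first by rewrite low; lra.
  have ln0 : 0 <= lam n by lra.
  rewrite ler_pM ?normc_ge0 ?divr_ge0 //.
  by rewrite ler_pdivrMr ?lam_gt0 // ler_peMr.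
have dgE n : (0 < n)%N -> forall e, 0 < e -> exists2 d, 0 < d & forall t,
  0 < t < d ->
    normc (g 1%N (1 - t)%:C - 1 + t%:C * derive1 (g n) 1) <= e * t.
  move=> n0 e e0.
  have dg : derivable (g n) 1 1 by apply: g_hol => //; apply: in_disc;
    rewrite normc1; lra.
  have [del d0 dP] := derivable_expansion dg e0.
  exists (Num.min del 1); first by rewrite lt_min d0 ltr01.
  move=> t /andP[t0]; rewrite lt_min => /andP[td t1].
  have := dP (- t%:C); rewrite normcN normc_real gtr0_norm // => /(_ td).
  have -> : 1 - t%:C = (1 - t)%:C by rewrite rmorphB.
  by rewrite g_1 // mulNr opprK (gE n 1%N) // one_disc // t0.
(* The sum [g m + eps m] is real there, being a real power series at a real point. Hence the
   imaginary part of [g] is that of [- eps m], at most [K / lam m], which tends to 0. *)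
have g_real t : 0 < t < 1 -> complex.Im (g 1%N (1 - t)%:C) = 0.
  move=> t01; apply/eqP; rewrite -normr_le0; apply/ler_addgt0Pr => e e0;
    rewrite add0r.
  have /cvgryPge/(_ (K / e))[N _ NP] := lam_div.
  pose m := maxn N 1.
  have m0 : (0 < m)%N by rewrite leq_maxr.
  have lm := NP m (leq_maxl _ _).
  have [c [cH _ _]] := coeffs m m0.
  have /cH : 0 < normc (1 - t)%:C < eta.
    rewrite one_disc // andbT normc_real normr_gt0; case/andP: t01; lra.
  move=> cv; have Im0 : complex.Im (g m (1 - t)%:C + eps m (1 - t)%:C) = 0.
    apply: (@csum_cvg_real _ (fun k => c k * (1 - t) ^+ k)).
    by apply: csum_cvg_eq cv => k; rewrite rmorphM rmorphXn.
  rewrite (gE 1%N m) ?one_disc //.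
  have -> : complex.Im (g m (1 - t)%:C) = - complex.Im (eps m (1 - t)%:C).
    move: Im0; case: (g m _) (eps m _) => [a b] [a' b'] /=; lra.
  rewrite normrN; apply: le_trans (normr_Im_le _) _.
  apply: le_trans (eps_t m t m0 t01) _; have /andP[t0 t1] := t01.
  apply: (@le_trans _ _ (K / lam m)).
    by rewrite ler_piMr ?divr_ge0 // ltW ?lam_gt0.
  rewrite ler_pdivrMr ?lam_gt0 // mulrC -ler_pdivrMr //.
pose A := derive1 (g 1%N) 1.
(* Two expansions of the same function near 1, compared at a common small [t], force the same
   slope. *)
have dA n : (0 < n)%N -> derive1 (g n) 1 = A.
  move=> n0; apply/eqP; rewrite -subr_eq0; apply/eqP/eq0_normc/eqP.
  rewrite eq_le normc_ge0 andbT; apply/ler_addgt0Pr => e e0; rewrite add0r.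
  have e2 : 0 < e / 2 by rewrite divr_gt0.
  have [del d0 dP] := dgE n n0 _ e2; have [del' d'0 dP'] := dgE 1%N isT _ e2.
  pose t := Num.min del del' / 2.
  have t0 : 0 < t by rewrite divr_gt0 // lt_min d0.
  have tlt : t < Num.min del del' by rewrite /t in t0 *; lra.
  move: (tlt); rewrite lt_min => /andP[td td'].
  have := dP t; rewrite t0 td => /(_ isT) b1.
  have := dP' t; rewrite t0 td' => /(_ isT) b2.
  rewrite -(ler_pM2l t0).
  have -> : t * normc (derive1 (g n) 1 - A) =
    normc (t%:C * (derive1 (g n) 1 - A)).
    by rewrite normcM normc_real gtr0_norm.
  have -> : t%:C * (derive1 (g n) 1 - A) =
      (g 1%N (1 - t)%:C - 1 + t%:C * derive1 (g n) 1) -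
        (g 1%N (1 - t)%:C - 1 + t%:C * A).
    by ring.
  apply: le_trans (normcB _ _) _; apply: le_trans (lerD b1 b2) _.
  by rewrite -mulrDl -splitr mulrC.
(* By [g_real] the difference quotients along the real axis are real. *)
have AE : A = (complex.Re A)%:C.
  suff : complex.Im A = 0 by case: (A) => u v /= ->.
  apply/eqP; rewrite -normr_le0; apply/ler_addgt0Pr => e e0; rewrite add0r.
  have [del d0 dP] := dgE 1%N isT _ e0.
  pose t := Num.min del 1 / 2.
  have t0 : 0 < t by rewrite divr_gt0 // lt_min d0 ltr01.
  have tlt : t < Num.min del 1 by rewrite /t in t0 *; lra.
  move: (tlt); rewrite lt_min => /andP[td t1].
  have := dP t; rewrite t0 td => /(_ isT); rewrite -/A =>
    /(le_trans (normr_Im_le _)).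
  have -> : complex.Im (g 1%N (1 - t)%:C - 1 + t%:C * A) = t * complex.Im A.
    have := g_real t; rewrite t0 t1 => /(_ isT).
    by case: (g _ _) (A) => [u v] [a b] /= ->; ring.
  by rewrite normrM gtr0_norm // mulrC ler_pM2r.
pose a := complex.Re A.
pose C := 2 * K + 2 * ((M + expR (- a) * expR (`|a| * r)) / (1 - r^-1) ^+ 3).
have /cvgryPge/(_ 1)[N _ NP] := lam_div.
(* [N] secures [lam n >= 1], as [HM] demands; [|C| + 1] is positive whatever the sign of [C]. *)
exists (maxn N 1), (`|C| + 1); split; first by rewrite leq_maxr.
split; first by rewrite ltr_wpDl.
move=> n; rewrite geq_max => /andP[Nn n0] /=; set mu := (lam n)%:C + _.
have ln := NP n Nn.
have l0 := lam_gt0 n n0.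
have muE : mu = (lam n + a)%:C by rewrite /mu dA // AE rmorphD.
have [c [cH cP cB]] := coeffs n n0.
have cM k : `|c k| * r ^+ k <= M.
  have [|B' B'P] := cB r; first by rewrite r0 /r; lra.
  rewrite -normc_real.
  apply: (@cauchy_estimate _ (fun k => (c k)%:C) (fun s => g n s + eps n s) r M
    B') => //.
  - by move=> m; apply: le_trans (B'P m); apply: ler_sum => j _;
    rewrite normc_real.
  - by move=> s sr; apply: cH; rewrite sr r0 /r; lra.
  - by move=> s; exact: HM.
have part m : \sum_(k < m) `|convol (poisson (lam n)) c k - poisson (lam n + a)
  k| <= C / lam n.
  apply: (@sum_poisson_approx_le _ _ _ _ _ _ _
    (fun t => g 1%N (1 - t)%:C) (fun t => eps n (1 - t)%:C)) => //.
  - move=> t t01; rewrite (gE 1%N n) ?one_disc //; apply: cH.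
    rewrite one_disc // andbT normc_real normr_gt0; case/andP: t01; lra.
  - by move=> e e0; rewrite -AE; exact: dgE.
  - by move=> t; exact: eps_t.
apply: lime_le.
  by apply: is_cvg_nneseries => k _ _; rewrite lee_fin normc_ge0.
apply: nearW => m; rewrite sumEFin lee_fin.
apply: le_trans (_ : C / lam n <= _); last first.
  by rewrite ler_pM2r ?invr_gt0 // (le_trans (ler_norm _)) // lerDl.
apply: le_trans (part (m - h)%N).
rewrite -{1}[h]add0n big_addn big_mkord; apply: ler_sum => k _.
rewrite addnK muE exp_coeffC_real -rmorphN expC_real -rmorphM -rmorphB
  normc_real.
by rewrite cP.
Qed.
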